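(* Let $n\ge1$ be an integer, $p>1$, $\alpha\in(0,\frac1p)$ and $A>0$, and put $\beta:=\frac{1-p\alpha}{2}>0$. Then the equation $u_t=u^p\Delta u$ possesses a radially symmetric positive classical self-similar solution $u_A^{(\alpha)}$ in $\mathbb{R}^n\times(0,\infty)$ which can be written in the form $$u_A^{(\alpha)}(x,t)=t^{-\alpha}f\left(t^{-\beta}|x|\right),\qquad x\in\mathbb{R}^n,\ t>0,$$ where $f:[0,\infty)\to(0,\infty)$ is the solution of the initial value problem $$f^p(\xi)\left(f''(\xi)+\frac{n-1}{\xi}f'(\xi)\right)+\beta\xi f'(\xi)+\alpha f(\xi)=0,\quad \xi>0,\qquad f(0)=A,\quad f'(0)=0.$$ Moreover, $f$ satisfies $$c(1+\xi)^{-\frac{\alpha}{\beta}}\le f(\xi)\le C(1+\xi)^{-\frac{\alpha}{\beta}}\qquad\text{for all }\xi\ge0$$ with appropriate positive constants $c$ and $C$.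
   Context: A positive classical solution of $u_t=u^p\Delta u$ in $\mathbb{R}^n\times(0,\infty)$ is a positive function in $C^{2,1}(\mathbb{R}^n\times(0,\infty))$ (twice continuously differentiable in $x$, once in $t$) satisfying the equation pointwise. *)

(* Defs.v *)
From HB Require Import structures.
From mathcomp Require Import all_boot all_order all_algebra.
From mathcomp Require Import all_classical all_reals all_analysis.
Set Implicit Arguments.
Unset Strict Implicit.
Unset Printing Implicit Defensive.
Import Order.TTheory GRing.Theory Num.Theory.
Import numFieldNormedType.Exports.
Local Open Scope classical_set_scope.
Local Open Scope ring_scope.

(* The library norm on ['rV[R]_n] is the sup norm; it induces the same
   topology as [enorm], but it is not the norm |x| of the self-similar form. *)
Definition enorm (R : realType) (n : nat) (x : 'rV[R]_n) : R :=
  Num.sqrt (\sum_(i < n) x ord0 i ^+ 2).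

Definition dspace (R : realType) (n : nat) (i : 'I_n)
    (u : 'rV[R]_n -> R -> R) : 'rV[R]_n -> R -> R :=
  fun x t => 'D_(delta_mx ord0 i) (fun y : 'rV[R]_n => u y t) x.

Definition dtime (R : realType) (n : nat)
    (u : 'rV[R]_n -> R -> R) : 'rV[R]_n -> R -> R :=
  fun x t => derive1 (u x) t.

Definition laplacian (R : realType) (n : nat)
    (u : 'rV[R]_n -> R -> R) : 'rV[R]_n -> R -> R :=
  fun x t => \sum_(i < n) dspace i (dspace i u) x t.

(* Joint continuity on R^n x (0, +oo); this set is open, so continuity in the
   ambient product space at each of its points is the right notion. *)
Definition continuous_Qoo (R : realType) (n : nat)
    (u : 'rV[R]_n -> R -> R) : Prop :=
  forall (x : 'rV[R]_n) (t : R), 0 < t ->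
    {for (x, t), continuous (fun z : 'rV[R]_n * R => u z.1 z.2)}.

(* C^{2,1}(R^n x (0, +oo)). The [derivable] fields are needed because
   ['D_v] and [derive1] are total operators. *)
Record class_C21 (R : realType) (n : nat) (u : 'rV[R]_n -> R -> R) : Prop :=
  ClassC21 {
  C21_derivable_t : forall (x : 'rV[R]_n) (t : R), 0 < t -> derivable (u x) t 1;
  C21_derivable_x : forall (i : 'I_n) (x : 'rV[R]_n) (t : R), 0 < t ->
    derivable (fun y : 'rV[R]_n => u y t) x (delta_mx ord0 i);
  C21_derivable_xx : forall (i j : 'I_n) (x : 'rV[R]_n) (t : R), 0 < t ->
    derivable (fun y : 'rV[R]_n => dspace i u y t) x (delta_mx ord0 j);
  C21_continuous : continuous_Qoo u;
  C21_continuous_t : continuous_Qoo (dtime u);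
  C21_continuous_x : forall i : 'I_n, continuous_Qoo (dspace i u);
  C21_continuous_xx : forall i j : 'I_n, continuous_Qoo (dspace j (dspace i u))
}.

Record positive_classical_solution (R : realType) (n : nat) (p : R)
    (u : 'rV[R]_n -> R -> R) : Prop := PositiveClassicalSolution {
  pcs_gt0 : forall (x : 'rV[R]_n) (t : R), 0 < t -> 0 < u x t;
  pcs_C21 : class_C21 u;
  pcs_eq : forall (x : 'rV[R]_n) (t : R), 0 < t ->
    dtime u x t = u x t `^ p * laplacian u x t
}.

Definition radially_symmetric (R : realType) (n : nat)
    (u : 'rV[R]_n -> R -> R) : Prop :=
  forall (x y : 'rV[R]_n) (t : R), 0 < t -> enorm x = enorm y -> u x t = u y t.

(* Positive solutions in C^1([0, +oo)) and C^2((0, +oo)) of the initial value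
   problem. A function on [0, +oo) is represented by a total function whose
   values on the negative half-line are irrelevant: at 0 only one-sided limits
   occur, and f'(0) is the right derivative. *)
Record ivp_solution (R : realType) (n : nat) (p alpha beta A : R)
    (f : R -> R) : Prop := IvpSolution {
  ivp_gt0 : forall xi : R, 0 <= xi -> 0 < f xi;
  ivp_continuous : {within `[0, +oo[, continuous f};
  ivp_derivable : forall xi : R, 0 < xi -> derivable f xi 1;
  ivp_derivable2 : forall xi : R, 0 < xi -> derivable (derive1 f) xi 1;
  ivp_continuous2 : forall xi : R, 0 < xi ->
    {for xi, continuous (derive1 (derive1 f))};
  ivp_ode : forall xi : R, 0 < xi ->
    f xi `^ p * (derive1 (derive1 f) xi + (n%:R - 1) / xi * derive1 f xi)
      + beta * xi * derive1 f xi + alpha * f xi = 0;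
  ivp_init : f 0 = A;
  ivp_deriv_init : h^-1 * (f h - f 0) @[h --> (0 : R)^'+] --> (0 : R);
  ivp_deriv_continuous0 : derive1 f xi @[xi --> (0 : R)^'+] --> (0 : R)
}.

(* Main.v *)
(** The equation says that xi^(n-1) f' has derivative
    - xi^(n-1) f^(-p) (beta xi f' + alpha f). Since f^(-p) f' is a derivative,
    one integration by parts gives f' = xi Q with
      Q(xi) = b w(xi) - (n b + alpha) xi^(-n) \int_0^xi s^(n-1) w(s) ds,
    where w = f^(1-p) and b = beta / (p - 1): a Volterra equation without
    singularity, solved on the whole half-line by Picard iteration once f is
    replaced in w by its maximum with a positive lower barrier m.

    A priori bounds show that f > m, so the truncation is never active. First
    Q < 0, so f decreases, and z = - f^(p-1) Q stays below kappa = alpha / n + 1. Then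
      E = (alpha / beta) ln xi + ln f - z / beta
    is nondecreasing, which bounds f below by a multiple of
    xi^(- alpha / beta). Conversely, with - Q <= B, the function
    E + (B f^(p-1) + (n / p) f^p) / beta is nonincreasing on [1, +oo), which is
    the upper bound. The contraction property also yields uniqueness, because
    the a priori bounds hold for every solution of the initial value problem.

    Finally u is a C^1 function of |x|^2, so its first derivatives in x are
    t^(- alpha - 2 beta) Q x_i, and the second ones are
    t^(- alpha - 2 beta) (delta_ij Q + x_i x_j (xi Q') / |x|^2), where xi Q'
    vanishes at the origin. *)
Require Import Defs.
From HB Require Import structures.
From mathcomp Require Import all_boot all_order all_algebra.
From mathcomp Require Import all_classical all_reals all_analysis.
From mathcomp Require Import ring lra.
Import Order.TTheory GRing.Theory Num.Theory.
Import numFieldNormedType.Exports.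
Local Open Scope classical_set_scope.
Local Open Scope ring_scope.
Set Implicit Arguments.
Unset Strict Implicit.
Unset Printing Implicit Defensive.

(** * One-variable calculus *)

(** The derivative is needed in the open interval only and continuity takes care of the end points,
    so that intervals starting at the singular point 0 of the equation are allowed. *)
Lemma ge0_derive_le (R : realType) (f df : R -> R) (a b : R) : a <= b ->
  (forall y, a <= y <= b -> {for y, continuous f}) ->
  (forall y, a < y < b -> is_derive y 1 f (df y)) ->
  (forall y, a < y < b -> 0 <= df y) -> f a <= f b.
Proof.
move=> ab cf df_f df0.
have cf' : {within `[a, b], continuous f}.
  apply: continuous_in_subspaceT => y /[!inE] /=; rewrite in_itv /=.
  exact: cf.
move: ab; rewrite le_eqVlt => /orP[/eqP ->//|ab].
have df1 : forall x, x \in `]a, b[ -> is_derive x 1 f (df x).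
  by move=> x; rewrite in_itv /=; apply: df_f.
have [c + E] := MVT ab df1 cf'.
rewrite in_itv /= => cab.
by rewrite -subr_ge0 E mulr_ge0 ?df0// subr_ge0 ltW.
Qed.

(** A first-zero argument. Let X be the supremum of the x such that g is positive on [0, x].
    Continuity and the hypothesis give g X > 0, and then continuity carries positivity beyond X. *)
Lemma pos_propagate (R : realType) (g : R -> R) (b : R) :
  (forall y, 0 <= y <= b -> {for y, continuous g}) -> 0 < g 0 ->
  (forall X, 0 < X <= b -> (forall y, 0 <= y < X -> 0 < g y) -> g X != 0) ->
  forall y, 0 <= y <= b -> 0 < g y.
Proof.
move=> cg g0 hg y /andP[y0 yb]; rewrite ltNge; apply/negP => gy.
pose S := [set x | 0 <= x <= y /\ forall s, 0 <= s <= x -> 0 < g s].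
have S0 : S 0.
  split; first by rewrite lexx.
  by move=> s /andP[s0 s1]; have -> : s = 0 by apply/eqP; rewrite eq_le s1.
have hS : has_sup S by split; [exists 0|exists y => x [] /andP[]].
pose X := sup S.
have X0 : 0 <= X by exact: ub_le_sup hS.2 _ S0.
have Xy : X <= y by apply: ge_sup; [exists 0|move=> x [] /andP[]].
have gX : forall s, 0 <= s < X -> 0 < g s.
  move=> s /andP[s0 sX].
  have [x Sx sx] := sup_gt (ex_intro _ 0 S0) sX.
  by apply: Sx.2; rewrite s0 ltW.
have Xb : 0 <= X <= b by rewrite X0 (le_trans Xy).
have gX_pos : 0 < g X.
  move: (X0); rewrite le_eqVlt => /orP[/eqP <-//|X_gt0].
  have nz : g X != 0 by apply: hg => //; rewrite X_gt0 (le_trans Xy).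
  rewrite lt_neqAle eq_sym nz /= leNgt; apply/negP => gneg.
  have /cvgr_lt /(_ _ gneg) := cg X Xb.
  rewrite near_nbhs => -[e /= e0 he].
  pose s := Num.max 0 (X - e / 2).
  have sX : 0 <= s < X by rewrite /s le_max lexx /= gt_max X_gt0 gtrBl divr_gt0.
  have := gX s sX; rewrite ltNge => /negP; apply; apply/ltW/he => /=.
  case/andP: sX => s0 sX; rewrite gtr0_norm ?subr_gt0//.
  have : X - e / 2 <= s by rewrite /s le_max lexx orbT.
  lra.
have XY : X < y.
  rewrite lt_neqAle Xy andbT; apply/negP => /eqP E.
  by move: gX_pos; rewrite E ltNge gy.
have /cvgr_gt /(_ _ gX_pos) := cg X Xb.
rewrite near_nbhs => -[e /= e0 he].
pose s := Num.min y (X + e / 2).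
have Xs : X < s by rewrite /s lt_min XY ltrDl divr_gt0.
have : S s.
  split; first by rewrite (le_trans X0 (ltW Xs)) /= /s ge_min lexx.
  move=> r /andP[r0 rs]; have [rX|Xr] := ltP r X; first by apply: gX; rewrite r0.
  apply: he => /=; rewrite ler0_norm ?subr_le0// opprB.
  have : s <= X + e / 2 by rewrite /s ge_min lexx orbT.
  lra.
by move/(ub_le_sup hS.2); rewrite leNgt Xs.
Qed.

Lemma derive_gt0_left (R : realType) (g : R -> R) (x d : R) :
  is_derive x 1 g d -> 0 < d ->
  exists2 e, 0 < e & forall y, x - e < y < x -> g y < g x.
Proof.
move=> [dg <-] d0.
have : h^-1 *: ((g \o shift x) (h *: 1) - g x) @[h --> 0^'] --> 'D_1 g x by [].
move=> /cvgr_gt /(_ _ d0) [e /= e0 he].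
exists e => // y /andP[y1 y2].
have : 0 < (y - x)^-1 * (g y - g x).
  have := he (y - x); rewrite /= sub0r normrN /GRing.scale /= mulr1 subrK; apply.
    by rewrite ltr0_norm ?subr_lt0//; lra.
  by rewrite subr_eq0 lt_eqF.
by rewrite nmulr_rgt0 ?invr_lt0 ?subr_lt0.
Qed.

(** At a zero reached from positive values the derivative cannot be positive. The bounds on Q are
    obtained in this way, by evaluating the equation at a hypothetical first zero. *)
Lemma pos_propagate_derive (R : realType) (g : R -> R) (b : R) :
  (forall y, 0 <= y <= b -> {for y, continuous g}) -> 0 < g 0 ->
  (forall X, 0 < X <= b -> (forall y, 0 <= y < X -> 0 < g y) -> g X = 0 ->
     exists2 d, 0 < d & is_derive X 1 g d) ->
  forall y, 0 <= y <= b -> 0 < g y.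
Proof.
move=> cg g0 hg; apply: pos_propagate => // X Xb gX; apply/eqP => gX0.
have [d d0 dg] := hg X Xb gX gX0.
have [e e0 he] := derive_gt0_left dg d0.
case/andP: Xb => X0 Xb.
pose y := Num.max 0 (X - e / 2).
have yX : 0 <= y < X by rewrite /y le_max lexx /= gt_max X0 gtrBl divr_gt0.
have : g y < g X.
  apply: he; case/andP: yX => _ ->; rewrite andbT.
  have : X - e / 2 <= y by rewrite /y le_max lexx orbT.
  lra.
by rewrite gX0 ltNge (ltW (gX _ yX)).
Qed.

(** The integral from 0 to x, written with base point -1 so that 0 is an interior point and the
    derivative at 0 is two-sided. *)
Definition primitive (R : realType) (g : R -> R) (x : R) : R :=
  (\int[lebesgue_measure]_(t in `[-1, x]) g t)%R -
  (\int[lebesgue_measure]_(t in `[-1, 0]) g t)%R.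

Lemma primitive0 (R : realType) (g : R -> R) : primitive g 0 = 0.
Proof. exact: subrr. Qed.

Lemma is_derive_primitive (R : realType) (g : R -> R) (x : R) :
  continuous g -> -1 < x -> is_derive x 1 (primitive g) (g x).
Proof.
move=> cg x1.
have ig : lebesgue_measure.-integrable `[-1, x + 1] (EFin \o g).
  apply: continuous_compact_integrable; first exact: segment_compact.
  exact: continuous_subspaceT.
have xx1 : x < x + 1 by rewrite ltrDl.
have [d1 d2] := continuous_FTC1_closed xx1 ig x1 (cg x).
have -> : primitive g = (fun y => (\int[lebesgue_measure]_(t in `[-1, y]) g t)%R)
   - cst ((\int[lebesgue_measure]_(t in `[-1, 0]) g t)%R) by [].
rewrite -[g x]subr0; apply: is_deriveB.
by rewrite -d2 derive1E; apply: derivableP.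
Qed.

(** * Rules of differentiation and comparison of increments *)

Lemma is_derive_continuous (R : realType) (f : R -> R) (x d : R) :
  is_derive x 1 f d -> {for x, continuous f}.
Proof.
by case=> df _; apply/differentiable_continuous/derivable1_diffP.
Qed.

Lemma is_derive_cast (R : realType) (f : R -> R) (x a b : R) :
  is_derive x 1 f a -> a = b -> is_derive x 1 f b.
Proof. by move=> ? <-. Qed.

Lemma is_deriveD_fun (R : realType) (f g : R -> R) (x a b : R) :
  is_derive x 1 f a -> is_derive x 1 g b ->
  is_derive x 1 (fun y => f y + g y) (a + b).
Proof. exact: is_deriveD. Qed.

Lemma is_deriveB_fun (R : realType) (f g : R -> R) (x a b : R) :
  is_derive x 1 f a -> is_derive x 1 g b ->
  is_derive x 1 (fun y => f y - g y) (a - b).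
Proof. exact: is_deriveB. Qed.

Lemma is_deriveM_fun (R : realType) (f g : R -> R) (x a b : R) :
  is_derive x 1 f a -> is_derive x 1 g b ->
  is_derive x 1 (fun y => f y * g y) (f x * b + g x * a).
Proof. exact: is_deriveM. Qed.

Lemma is_deriveZ_fun (R : realType) (k : R) (f : R -> R) (x a : R) :
  is_derive x 1 f a -> is_derive x 1 (fun y => k * f y) (k * a).
Proof. exact: is_deriveZ. Qed.

Lemma is_deriveN_fun (R : realType) (f : R -> R) (x a : R) :
  is_derive x 1 f a -> is_derive x 1 (fun y => - f y) (- a).
Proof. exact: is_deriveN. Qed.

Lemma is_deriveXn (R : realType) (n : nat) (x : R) :
  is_derive x 1 (fun y : R => y ^+ n) (n%:R * x ^+ n.-1).
Proof.
elim: n => [|n IH].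
  rewrite mul0r (_ : (fun y : R => y ^+ 0) = cst 1); first exact: is_derive_cst.
  by apply/funext => y; rewrite expr0.
rewrite (_ : (fun y : R => y ^+ n.+1) = (fun y => y * y ^+ n)); last first.
  by apply/funext => y; rewrite exprS.
apply: (is_derive_cast (is_deriveM_fun (is_derive_id x 1) IH)).
case: n {IH} => [|n] /=; first by ring.
by rewrite exprS -[in RHS]natr1; ring.
Qed.

Lemma is_derive_comp_fun (R : realType) (f g : R -> R) (x a b : R) :
  is_derive x 1 f a -> is_derive (f x) 1 g b ->
  is_derive x 1 (fun y => g (f y)) (b * a).
Proof. by move=> df dg; apply: is_derive1_comp. Qed.

Lemma is_deriveV_fun (R : realType) (f : R -> R) (x a : R) :
  is_derive x 1 f a -> f x != 0 -> is_derive x 1 (fun y => (f y)^-1) (- a / f x ^+ 2).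
Proof.
move=> df fx0; apply: is_derive_cast.
by rewrite /GRing.scale /=; field.
Qed.

Lemma is_derive_ln_fun (R : realType) (f : R -> R) (x a : R) :
  is_derive x 1 f a -> 0 < f x -> is_derive x 1 (fun y => ln (f y)) (a / f x).
Proof.
move=> df fx0; rewrite mulrC.
exact: is_derive_comp_fun df (is_derive1_ln fx0).
Qed.

Lemma is_derive_powR_fun (R : realType) (r : R) (f : R -> R) (x a : R) :
  is_derive x 1 f a -> 0 < f x ->
  is_derive x 1 (fun y => f y `^ r) (r * f x `^ (r - 1) * a).
Proof.
move=> df fx0.
exact: is_derive_comp_fun df (is_derive1_powR r fx0).
Qed.

(** H + D and H - D are both nondecreasing. This serves as the bound of an integral by the integral
    of a majorant. *)
Lemma normB_derive_le (R : realType) (D D' H H' : R -> R) (x : R) : 0 <= x ->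
  (forall y, 0 <= y <= x -> is_derive y 1 D (D' y)) ->
  (forall y, 0 <= y <= x -> is_derive y 1 H (H' y)) ->
  (forall y, 0 <= y <= x -> `|D' y| <= H' y) ->
  `|D x - D 0| <= H x - H 0.
Proof.
move=> x0 dD dH DH.
have w y : 0 < y < x -> 0 <= y <= x by move=> /andP[/ltW -> /ltW ->].
rewrite ler_norml; apply/andP; split.
  suff : H 0 + D 0 <= H x + D x by lra.
  apply: (@ge0_derive_le R (fun y => H y + D y) (fun y => H' y + D' y)) => //.
  - by move=> y yx; apply: (is_derive_continuous (is_deriveD_fun (dH y yx) (dD y yx))).
  - by move=> y /w yx; apply: is_deriveD_fun; [exact: dH|exact: dD].
  - by move=> y /w /DH; rewrite ler_norml => /andP[]; lra.
suff : H 0 - D 0 <= H x - D x by lra.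
apply: (@ge0_derive_le R (fun y => H y - D y) (fun y => H' y - D' y)) => //.
- by move=> y yx; apply: (is_derive_continuous (is_deriveB_fun (dH y yx) (dD y yx))).
- by move=> y /w yx; apply: is_deriveB_fun; [exact: dH|exact: dD].
- by move=> y /w /DH; rewrite ler_norml => /andP[]; lra.
Qed.

(** * Averages with the weight s^(n-1) *)

Definition weighted (R : realType) (n : nat) (w : R -> R) (s : R) : R :=
  s ^+ n.-1 * w s.

Lemma weighted_continuous (R : realType) (n : nat) (w : R -> R) :
  continuous w -> continuous (weighted n w).
Proof.
by move=> cw x; apply: cvgM; [exact: exprn_continuous|exact: cw].
Qed.

Lemma primitive_weighted_dist (R : realType) (n : nat) (w v : R -> R) (M x : R) :
  (0 < n)%N -> continuous w -> continuous v -> 0 <= x ->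
  (forall s, 0 <= s <= x -> `|w s - v s| <= M) ->
  `|primitive (weighted n w) x - primitive (weighted n v) x| <= M * (x ^+ n / n%:R).
Proof.
move=> n0 cw cv x0 wv.
have lt1 y : 0 <= y <= x -> -1 < y by move=> /andP[y0 _]; apply: lt_le_trans y0; lra.
have nn : n%:R != 0 :> R by rewrite pnatr_eq0 -lt0n.
have := @normB_derive_le R
  (fun y => primitive (weighted n w) y - primitive (weighted n v) y)
  (fun y => weighted n w y - weighted n v y)
  (fun y => (M / n%:R) * y ^+ n) (fun y => (M / n%:R) * (n%:R * y ^+ n.-1)) x x0.
rewrite !primitive0 subrr subr0 expr0n eqn0Ngt n0 /= mulr0 subr0.
have -> : M / n%:R * x ^+ n = M * (x ^+ n / n%:R) by rewrite mulrAC mulrA.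
apply.
- move=> y /lt1 y1; apply: is_deriveB_fun; apply: is_derive_primitive => //;
  exact: weighted_continuous.
- by move=> y _; apply: is_deriveZ_fun; exact: is_deriveXn.
- move=> y yx; rewrite /weighted -mulrBr normrM mulrA divfK// mulrC.
  have /andP[y0 _] := yx.
  by rewrite (ger0_norm (x := y ^+ n.-1)) ?exprn_ge0// ler_wpM2r ?exprn_ge0// wv.
Qed.

(* The value at [xi = 0] is the limit of the other branch. *)
Definition average (R : realType) (n : nat) (w : R -> R) (xi : R) : R :=
  if xi == 0 then w 0 / n%:R else primitive (weighted n w) xi / xi ^+ n.

(** The weight s^(n-1) / x^n has total mass 1/n on [0, x], which explains the factor 1/n here and in
    the value of [average] at 0. *)
Lemma average_dist (R : realType) (n : nat) (w v : R -> R) (M x : R) :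
  (0 < n)%N -> continuous w -> continuous v -> 0 <= x ->
  (forall s, 0 <= s <= x -> `|w s - v s| <= M) ->
  `|average n w x - average n v x| <= M / n%:R.
Proof.
move=> n0 cw cv x0 wv; rewrite /average; case: eqVneq => [xE|xn0].
  rewrite -mulrBl normrM (ger0_norm (x := n%:R^-1)) ?invr_ge0//.
  by rewrite ler_wpM2r ?invr_ge0// wv// lexx.
have xp : 0 < x by rewrite lt_neqAle eq_sym xn0.
have xn : 0 < x ^+ n by rewrite exprn_gt0.
rewrite -mulrBl normrM (ger0_norm (x := (x ^+ n)^-1)) ?invr_ge0 ?(ltW xn)//.
rewrite ler_pdivrMr// -mulrA [_^-1 * _]mulrC.
exact: primitive_weighted_dist.
Qed.

Lemma average_cst (R : realType) (n : nat) (c x : R) : (0 < n)%N -> 0 <= x ->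
  average n (fun=> c) x = c / n%:R.
Proof.
move=> n0 x0; rewrite /average; case: eqVneq => // xn0.
have nn : n%:R != 0 :> R by rewrite pnatr_eq0 -lt0n.
have xn : x ^+ n != 0 by rewrite expf_neq0.
have cc : continuous (fun _ : R => c) by move=> y; exact: cst_continuous.
have := @normB_derive_le R
  (fun y => primitive (weighted n (fun=> c)) y - (c / n%:R) * y ^+ n)
  (fun y => 0) (fun=> 0) (fun=> 0) x x0.
rewrite primitive0 expr0n eqn0Ngt n0 /= mulr0 !subr0.
move=> H; suff : `|primitive (weighted n (fun=> c)) x - c / n%:R * x ^+ n| <= 0.
  by rewrite normr_le0 subr_eq0 => /eqP ->; rewrite mulfK.
apply: H.
- move=> y /andP[y0 _]; apply: is_derive_cast.
    apply: is_deriveB_fun; last by apply: is_deriveZ_fun; exact: is_deriveXn.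
    apply: is_derive_primitive; last by apply: lt_le_trans y0; lra.
    exact: weighted_continuous.
  by rewrite /weighted; field.
- by move=> y _; rewrite normr0.
Qed.

Lemma is_derive_average (R : realType) (n : nat) (w : R -> R) (x : R) :
  (0 < n)%N -> continuous w -> 0 < x ->
  is_derive x 1 (average n w) ((w x - n%:R * average n w x) / x).
Proof.
move=> n0 cw x0; have xn0 : x != 0 by rewrite gt_eqF.
apply: (@near_eq_is_derive _ _ _
  (fun y => primitive (weighted n w) y * (y ^+ n)^-1)).
  near=> y; rewrite /average gt_eqF//; near: y; exact: lt_nbhsr.
have xn : x ^+ n != 0 by rewrite expf_neq0.
have dP : is_derive x 1 (primitive (weighted n w)) (weighted n w x).
  apply: is_derive_primitive; last by apply: lt_trans x0; lra.
  exact: weighted_continuous.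
apply: (is_derive_cast (is_deriveM_fun dP (is_deriveV_fun (is_deriveXn n x) xn))).
rewrite /average gt_eqF// /weighted.
have -> : x ^+ n = x * x ^+ n.-1 by rewrite -exprS prednK.
have c0 : x ^+ n.-1 != 0 by rewrite expf_neq0.
set P := primitive _ x; move: (x ^+ n.-1) c0 P => c c0 P.
by field; rewrite xn0 c0.
Unshelve. all: by end_near.
Qed.

(** The square root sends q <= 0 to 0, so the function lives on the whole line. Where it vanishes,
    [average_dist] compares w with the constant w 0, whose average is w 0 / n at every radius. *)
Lemma average_sqrt_continuous (R : realType) (n : nat) (w : R -> R) :
  (0 < n)%N -> continuous w ->
  continuous (fun q : R => average n w (Num.sqrt q)).
Proof.
move=> n0 cw q.
have [q0|q0] := ltP 0 q.
  apply: (@continuous_comp _ _ _ (@Num.sqrt R) (average n w)).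
    exact: sqrt_continuous.
  by apply: is_derive_continuous; apply: is_derive_average; rewrite ?sqrtr_gt0.
have sq0 : Num.sqrt q = 0 by apply/eqP; rewrite sqrtr_eq0.
apply/cvgrPdist_le => e e0.
have n0R : 0 < n%:R :> R by rewrite ltr0n.
have en0 : 0 < e * n%:R by rewrite mulr_gt0.
have := cw 0 => /cvgrPdist_le /(_ _ en0); rewrite near_nbhs => -[d /= d0 hd].
have := @sqrt_continuous R q; rewrite /continuous_at sq0 => /cvgr_lt /(_ _ d0).
apply: filterS => r rd.
have cc : continuous (fun _ : R => w 0) by move=> y; exact: cst_continuous.
have -> : average n w 0 = average n (fun=> w 0) (Num.sqrt r).
  by rewrite average_cst ?sqrtr_ge0// /average eqxx.
rewrite (le_trans (average_dist (M := e * n%:R) n0 cc cw (sqrtr_ge0 r) _))//.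
  move=> s /andP[s0 sr]; apply: hd => /=.
  by rewrite sub0r normrN ger0_norm// (le_lt_trans sr).
by rewrite mulfK// gt_eqF.
Qed.

(** * A priori bounds *)

Lemma powR_pred (R : realType) (x r : R) : 0 < x -> x `^ (r - 1) = x `^ r / x.
Proof.
by move=> x0; rewrite powRB ?powRr1 ?ltW//; apply/implyP => _; rewrite gt_eqF.
Qed.

Lemma powR_opp_pred (R : realType) (x r : R) : x `^ (1 - r) = (x `^ (r - 1))^-1.
Proof. by rewrite -powRN opprB. Qed.

Lemma powR_succ (R : realType) (x r : R) : 0 < x -> x `^ r = x `^ (r - 1) * x.
Proof. by move=> x0; rewrite powR_pred// divfK// gt_eqF. Qed.

(* [flux] is xi * (f'/xi)', as read off the equation with [Q] for f'/xi. *)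
Definition flux (R : realType) (n : nat) (p alpha beta : R) (f Q : R -> R)
    (xi : R) : R :=
  - (beta * xi ^+ 2 * f xi `^ (- p) * Q xi) - alpha * f xi `^ (1 - p)
  - n%:R * Q xi.

(** The equation on (0, X) as a first-order system for f and Q = f'/xi. The value of Q at 0 is
    forced by the limit n A^p Q(0) + alpha A = 0 of the equation. Continuity is global, so no limit
    at X has to be constructed. *)
Record profile (R : realType) (n : nat) (p alpha beta A : R) (f Q : R -> R)
    (X : R) : Prop := Profile {
  prof_cont : continuous f;
  prof_contQ : continuous Q;
  prof_init : f 0 = A;
  prof_initQ : Q 0 = - (alpha / n%:R) * A `^ (1 - p);
  prof_gt0 : forall xi, 0 <= xi < X -> 0 < f xi;
  prof_derive : forall xi, 0 < xi < X -> is_derive xi 1 f (xi * Q xi);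
  prof_deriveQ : forall xi, 0 < xi < X ->
    is_derive xi 1 Q (flux n p alpha beta f Q xi / xi)
}.

(** The bound for z = - f^(p-1) Q: alpha / n is the value of z at 0, and the summand 1 makes the
    inequality strict. *)
Definition kappa (R : realType) (n : nat) (alpha : R) : R := alpha / n%:R + 1.

(** On this radius p kappa xi^2 <= A^p, which keeps f above A / 2. The cap at 1 makes its positive
    powers at most 1. *)
Definition near_radius (R : realType) (n : nat) (p alpha A : R) : R :=
  Num.min 1 (Num.sqrt (A `^ p / (p * kappa n alpha))).

(** Half of the constant that results from comparing the energy at xi with its value at
    [near_radius], where f >= A / 2. The spare factor 2 keeps f strictly away from the barrier. *)
Definition floor_coef (R : realType) (n : nat) (p alpha beta A : R) : R :=
  A / 4 * expR (- (kappa n alpha / beta)) *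
  near_radius n p alpha A `^ (alpha / beta).

Definition floor_fun (R : realType) (n : nat) (p alpha beta A xi : R) : R :=
  floor_coef n p alpha beta A * (1 + `|xi|) `^ (- (alpha / beta)).

(** * Sign, slope bound and lower barrier for a profile on [0, X) *)

Section apriori.
Context (R : realType) (n : nat) (p alpha beta A : R).
Context (n_gt0 : (0 < n)%N) (p_gt1 : 1 < p) (alpha_gt0 : 0 < alpha)
  (beta_gt0 : 0 < beta) (A_gt0 : 0 < A).

Let nR : 0 < n%:R :> R. Proof. by rewrite ltr0n. Qed.
Let p_gt0 : 0 < p. Proof. by rewrite (lt_trans ltr01). Qed.
Let p1_ge0 : 0 <= p - 1. Proof. by rewrite subr_ge0 ltW. Qed.

Lemma kappa_gt0 : 0 < kappa n alpha.
Proof. by rewrite /kappa addr_gt0// divr_gt0. Qed.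

Lemma near_radius_gt0 : 0 < near_radius n p alpha A.
Proof.
rewrite /near_radius lt_min ltr01 sqrtr_gt0 divr_gt0 ?powR_gt0//.
by rewrite mulr_gt0 ?kappa_gt0.
Qed.

Lemma floor_coef_gt0 : 0 < floor_coef n p alpha beta A.
Proof.
by rewrite /floor_coef !mulr_gt0 ?expR_gt0 ?powR_gt0 ?near_radius_gt0.
Qed.

Lemma floor_fun_gt0 xi : 0 < floor_fun n p alpha beta A xi.
Proof.
by rewrite /floor_fun mulr_gt0 ?floor_coef_gt0// powR_gt0// ltr_pwDl.
Qed.

Context (f Q : R -> R) (X : R) (pr : profile n p alpha beta A f Q X).

Let w xi : 0 < xi < X -> 0 <= xi < X.
Proof. by case/andP=> /ltW -> ->. Qed.

(** Where Q vanishes, xi Q' reduces to - alpha f^(1-p) < 0, so - Q has no first zero. *)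
Lemma profile_Q_lt0 xi : 0 <= xi < X -> Q xi < 0.
Proof.
move=> /andP[x0 xX].
suff : 0 < - Q xi by rewrite oppr_gt0.
apply: (@pos_propagate_derive R (fun y => - Q y) xi); last by rewrite x0 lexx.
- by move=> y _; apply: cvgN; exact: (prof_contQ pr).
- by rewrite (prof_initQ pr) mulNr opprK mulr_gt0 ?powR_gt0 ?divr_gt0.
move=> Y /andP[Y0 Yx] _ /eqP; rewrite oppr_eq0 => /eqP QY.
have YX : 0 < Y < X by rewrite Y0 (le_lt_trans Yx).
exists (- (flux n p alpha beta f Q Y / Y)); last first.
  by apply: is_deriveN_fun; exact: (prof_deriveQ pr).
rewrite /flux QY !mulr0 subr0 oppr0 add0r mulNr opprK.
by rewrite divr_gt0// mulr_gt0// powR_gt0// (prof_gt0 pr)// w.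
Qed.

Lemma profile_le xi : 0 <= xi < X -> f xi <= A.
Proof.
move=> /andP[x0 xX]; rewrite -(prof_init pr) -lerN2.
apply: (@ge0_derive_le R (fun y => - f y) (fun y => - (y * Q y))) => //.
- by move=> y _; apply: cvgN; exact: (prof_cont pr).
- move=> y /andP[y0 yx]; apply: is_deriveN_fun; apply: (prof_derive pr).
  by rewrite y0 (lt_trans yx).
move=> y /andP[y0 yx]; rewrite oppr_ge0 mulr_ge0_le0 ?(ltW y0)// ltW//.
by apply: profile_Q_lt0; rewrite ltW//= (lt_trans yx).
Qed.

(** The factor f^(p-1) turns two terms of Q' into - beta (ln f)' and - alpha (ln xi)', because (ln
    f)' = xi Q / f. These exact derivatives are what [energy] removes. *)
Lemma profile_is_derive_slope xi : 0 < xi < X ->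
  is_derive xi 1 (fun y => f y `^ (p - 1) * Q y)
    (((p - 1) * f xi `^ (p - 1) / f xi * xi * Q xi ^+ 2)
     - beta * xi * Q xi / f xi - alpha / xi
     - n%:R * (f xi `^ (p - 1) * Q xi) / xi).
Proof.
move=> xX; have f0 := prof_gt0 pr (w xX).
have D := is_derive_powR_fun (p - 1) (prof_derive pr xX) f0.
apply: (is_derive_cast (is_deriveM_fun D (prof_deriveQ pr xX))).
rewrite /flux powRN (powR_succ p f0) powR_opp_pred (powR_pred (p - 1) f0).
have : f xi `^ (p - 1) != 0 by rewrite gt_eqF ?powR_gt0.
have : xi != 0 by case/andP: xX => x0 _; rewrite gt_eqF.
have : f xi != 0 by rewrite gt_eqF.
move: (f xi `^ (p - 1)) (f xi) (Q xi) => F g q g0 x0 F0.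
by field; rewrite g0 x0 F0.
Qed.

Let slope_cont (y : R) : 0 < f y ->
  {for y, continuous (fun y => f y `^ (p - 1) * Q y)}.
Proof.
move=> fy; apply: cvgM; last exact: (prof_contQ pr).
apply: (@continuous_comp _ _ _ f (fun z => z `^ (p - 1))).
  exact: (prof_cont pr).
exact: is_derive_continuous (is_derive1_powR (p - 1) fy).
Qed.

(** If f^(p-1) Q reaches - kappa at Y, the last term of its derivative is n kappa / Y = alpha / Y +
    n / Y. This outweighs - alpha / Y, and the other two terms are nonnegative since Q < 0. *)
Lemma profile_slope_lt xi : 0 <= xi < X ->
  - (f xi `^ (p - 1) * Q xi) < kappa n alpha.
Proof.
move=> /andP[x0 xX].
suff : 0 < kappa n alpha + f xi `^ (p - 1) * Q xi by lra.
apply: (@pos_propagate_derive R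
  (fun y => kappa n alpha + f y `^ (p - 1) * Q y) xi); last by rewrite x0 lexx.
- move=> y /andP[y0 yx]; apply: cvgD; first exact: cvg_cst.
  by apply: slope_cont; apply: (prof_gt0 pr); rewrite y0 (le_lt_trans yx).
- rewrite (prof_initQ pr) (prof_init pr) powR_opp_pred mulrCA mulfV; last first.
    by rewrite gt_eqF// powR_gt0.
  by rewrite mulr1 /kappa; lra.
move=> Y /andP[Y0 Yx] _ E.
have YX : 0 < Y < X by rewrite Y0 (le_lt_trans Yx).
have D := profile_is_derive_slope YX.
have f0 := prof_gt0 pr (w YX).
have Q0 := profile_Q_lt0 (w YX).
have {}E : f Y `^ (p - 1) * Q Y = - kappa n alpha by lra.
eexists; last exact: is_deriveD_fun (is_derive_cst (kappa n alpha) Y 1) D.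
rewrite add0r E.
have -> : n%:R * - kappa n alpha / Y = - (alpha / Y) - n%:R / Y.
  by rewrite /kappa; field; rewrite !gt_eqF.
have : 0 <= (p - 1) * f Y `^ (p - 1) / f Y * Y * Q Y ^+ 2.
  rewrite mulr_ge0 ?sqr_ge0// mulr_ge0 ?(ltW Y0)// divr_ge0 ?(ltW f0)//.
  by rewrite mulr_ge0 ?powR_ge0.
have : 0 <= - (beta * Y * Q Y / f Y).
  rewrite -mulNr divr_ge0 ?(ltW f0)// oppr_ge0 mulr_ge0_le0 ?(ltW Q0)//.
  by rewrite mulr_ge0 ?ltW.
have : 0 < n%:R / Y by rewrite divr_gt0.
lra.
Qed.

(** Since (f^p)' = p xi f^(p-1) Q > - p kappa xi, the function f^p + p kappa xi^2 / 2 is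
    nondecreasing. Within [near_radius] it leaves f^p >= A^p / 2. *)
Lemma profile_near_ge xi : 0 <= xi < X -> xi <= near_radius n p alpha A ->
  A / 2 <= f xi.
Proof.
move=> /andP[x0 xX] xr.
have f0 : 0 < f xi by apply: (prof_gt0 pr); rewrite x0.
have k0 := kappa_gt0.
have pk0 : 0 < p * kappa n alpha by rewrite mulr_gt0.
have H : A `^ p <= f xi `^ p + p * kappa n alpha / 2 * xi ^+ 2.
  have -> : A `^ p = f 0 `^ p + p * kappa n alpha / 2 * 0 ^+ 2.
    by rewrite (prof_init pr) expr0n mulr0 addr0.
  apply: (@ge0_derive_le R
    (fun y => f y `^ p + p * kappa n alpha / 2 * y ^+ 2)
    (fun y => p * f y `^ (p - 1) * (y * Q y) +
              p * kappa n alpha / 2 * (2 * y ^+ 1))) => //.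
  - move=> y /andP[y0 yx]; have fy : 0 < f y.
      by apply: (prof_gt0 pr); rewrite y0 (le_lt_trans yx).
    apply: cvgD.
      apply: (@continuous_comp _ _ _ f (fun z => z `^ p)).
        exact: (prof_cont pr).
      exact: is_derive_continuous (is_derive1_powR p fy).
    by apply: cvgM; [exact: cvg_cst|exact: exprn_continuous].
  - move=> y /andP[y0 yx]; have yX : 0 < y < X by rewrite y0 (lt_trans yx).
    apply: is_deriveD_fun.
      apply: is_derive_powR_fun; last exact: (prof_gt0 pr (w yX)).
      exact: (prof_derive pr).
    by apply: is_deriveZ_fun; exact: is_deriveXn.
  - move=> y /andP[y0 yx]; have yX : 0 < y < X by rewrite y0 (lt_trans yx).
    have := profile_slope_lt (w yX); rewrite expr1 => S.
    have -> : p * f y `^ (p - 1) * (y * Q y) + p * kappa n alpha / 2 * (2 * y)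
      = p * y * (kappa n alpha - - (f y `^ (p - 1) * Q y)) by field.
    rewrite mulr_ge0//; last by rewrite subr_ge0 ltW.
    by rewrite mulr_ge0 ?(ltW y0) ?(ltW p_gt0).
have x2 : p * kappa n alpha * xi ^+ 2 <= A `^ p.
  rewrite mulrC -ler_pdivlMr//.
  have : xi <= Num.sqrt (A `^ p / (p * kappa n alpha)).
    by rewrite (le_trans xr)// /near_radius ge_min lexx orbT.
  rewrite -(ler_pXn2r (n := 2)) ?nnegrE ?sqrtr_ge0//.
  by rewrite sqr_sqrtr// divr_ge0 ?powR_ge0 ?(ltW pk0).
have {}H : A `^ p / 2 <= f xi `^ p by lra.
rewrite leNgt; apply/negP => fA.
have A2 : 0 < A / 2 by lra.
have h1 : f xi `^ p < (A / 2) `^ p.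
  by apply: gt0_ltr_powR; rewrite ?nnegrE ?(ltW f0) ?(ltW A2).
(* Here p >= 1 enters, through 2^(-p) <= 1/2. *)
have h2 : (A / 2) `^ p <= A `^ p / 2.
  rewrite powRM ?(ltW A_gt0) ?invr_ge0// ler_wpM2l ?powR_ge0//.
  apply: ge1r_powR; last exact: ltW.
  by rewrite invr_gt0 ltr0n invf_le1 ?ltr0n// ler1n.
have := le_lt_trans H (lt_le_trans h1 h2); rewrite ltxx.
by [].
Qed.

Definition energy (xi : R) : R :=
  alpha / beta * ln xi + ln (f xi) + f xi `^ (p - 1) * Q xi / beta.

(** The logarithms cancel the terms with beta and alpha in the derivative of f^(p-1) Q. What remains
    is a square term and - n f^(p-1) Q / xi, both nonnegative because Q < 0. *)
Lemma is_derive_energy xi : 0 < xi < X ->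
  is_derive xi 1 energy
    (((p - 1) * f xi `^ (p - 1) / f xi * xi * Q xi ^+ 2
      - n%:R * (f xi `^ (p - 1) * Q xi) / xi) / beta).
Proof.
move=> xX; have f0 := prof_gt0 pr (w xX).
have x0 : 0 < xi by case/andP: xX.
have D1 := is_deriveZ_fun (alpha / beta) (is_derive1_ln x0).
have D2 := is_derive_ln_fun (prof_derive pr xX) f0.
have D3 := is_deriveZ_fun beta^-1 (profile_is_derive_slope xX).
have -> : energy = (fun y => alpha / beta * ln y + ln (f y)
    + beta^-1 * (f y `^ (p - 1) * Q y)).
  by apply/funext => y; rewrite /energy [X in _ = _ + X]mulrC.
apply: (is_derive_cast (is_deriveD_fun (is_deriveD_fun D1 D2) D3)).
by field; rewrite !gt_eqF.
Qed.

Lemma energy_le x y : 0 < x -> x <= y -> y < X -> energy x <= energy y.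
Proof.
move=> x0 xy yX.
have in_dom z : x <= z <= y -> 0 < z < X.
  by move=> /andP[/(lt_le_trans x0) -> /le_lt_trans ->].
have wk z : x < z < y -> x <= z <= y by case/andP=> /ltW -> /ltW ->.
apply: (@ge0_derive_le R energy _ x y xy _
  (fun z hz => is_derive_energy (in_dom z (wk z hz)))).
  by move=> z /in_dom /is_derive_energy; exact: is_derive_continuous.
move=> z /wk /in_dom zX.
have f0 := prof_gt0 pr (w zX); have Q0 := profile_Q_lt0 (w zX).
have z0 : 0 < z by case/andP: zX.
rewrite divr_ge0 ?(ltW beta_gt0)// subr_ge0 (@le_trans _ _ 0)//.
  rewrite pmulr_lle0 ?invr_gt0// pmulr_rle0// mulr_ge0_le0 ?powR_ge0//.
  exact: ltW.
rewrite mulr_ge0 ?sqr_ge0// mulr_ge0 ?(ltW z0)// divr_ge0 ?(ltW f0)//.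
by rewrite mulr_ge0 ?powR_ge0.
Qed.

(** Within [near_radius] the factors next to A / 2 are at most 1. Beyond it, the energy is at least
    its value at [near_radius]; its last term is at least - kappa / beta there and at most 0 at xi.
    Taking exponentials gives the barrier. *)
Lemma profile_ge_floor xi : 0 <= xi < X ->
  2 * floor_fun n p alpha beta A xi <= f xi.
Proof.
move=> xX; have /andP[x0 _] := xX.
have f0 := prof_gt0 pr xX.
have k0 := kappa_gt0; have r0 := near_radius_gt0.
have a0 : 0 < alpha / beta by rewrite divr_gt0.
have E0 : expR (- (kappa n alpha / beta)) <= 1.
  by rewrite -expR0 ler_expR oppr_le0 divr_ge0 ?ltW.
have [xr|rx] := leP xi (near_radius n p alpha A).
  apply: le_trans (profile_near_ge xX xr).
  suff : expR (- (kappa n alpha / beta)) * near_radius n p alpha A `^ (alpha / beta)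
     * (1 + `|xi|) `^ (- (alpha / beta)) <= 1.
    rewrite /floor_fun /floor_coef => H.
    have := ler_wpM2l (ltW A_gt0) H; lra.
  rewrite !mulr_ile1 ?mulr_ge0 ?expR_ge0 ?powR_ge0//.
    rewrite -[leRHS](powRr0 (near_radius n p alpha A)) ger_powR ?(ltW a0)//.
    by rewrite r0 /near_radius ge_min lexx.
  by rewrite powRN invf_le1 ?powR_gt0 ?ltr_pwDl// -[leLHS](powRr0 (1 + `|xi|))
    ler_powR ?(ltW a0)// lerDl.
have xp : 0 < xi := lt_trans r0 rx.
have rX : 0 <= near_radius n p alpha A < X.
  by rewrite (ltW r0) (lt_trans rx)//; case/andP: xX.
have hr : A / 2 <= f (near_radius n p alpha A) by exact: profile_near_ge.
have fr : 0 < f (near_radius n p alpha A) by exact: (prof_gt0 pr).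
have := energy_le r0 (ltW rx) (andP xX).2; rewrite /energy => H.
have Sr := profile_slope_lt rX.
have Qx := profile_Q_lt0 xX.
have h1 : f xi `^ (p - 1) * Q xi / beta <= 0.
  by rewrite pmulr_lle0 ?invr_gt0// mulr_ge0_le0 ?powR_ge0 ?(ltW Qx).
set r := near_radius n p alpha A in r0 rx rX hr fr Sr H *.
have h2 : - (kappa n alpha / beta) <= f r `^ (p - 1) * Q r / beta.
  by rewrite -mulNr ler_pM2r ?invr_gt0//; lra.
have A2 : 0 < A / 2 by rewrite divr_gt0.
have h3 : ln (A / 2) <= ln (f r) by rewrite ler_ln ?posrE.
have x1 : 0 < 1 + `|xi| by rewrite ltr_pwDl.
have h4 : ln xi <= ln (1 + `|xi|).
  by rewrite ler_ln ?posrE// (ger0_norm x0); lra.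
have h5 : alpha / beta * ln xi <= alpha / beta * ln (1 + `|xi|).
  by rewrite ler_pM2l.
rewrite -ler_ln ?posrE ?mulr_gt0 ?floor_fun_gt0//.
have -> : 2 * floor_fun n p alpha beta A xi = A / 2 *
   expR (- (kappa n alpha / beta)) * r `^ (alpha / beta) *
   (1 + `|xi|) `^ (- (alpha / beta)).
  by rewrite /floor_fun /floor_coef -/r; field.
move: (A / 2) A2 h3 => B B0 h3.
rewrite !lnM ?posrE ?mulr_gt0 ?expR_gt0 ?powR_gt0// expRK !ln_powR.
- by lra.
- by rewrite expR_gt0.
- by rewrite powR_gt0.
Qed.

End apriori.

(** The added terms have derivatives proportional to Q, which absorb the growth of the energy. Minus
    the total derivative is a sum of a nonnegative multiple of (- Q) (B + Q) and one of (- Q) (z -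
    1/z), hence the need for - Q <= B and z >= 1. *)
Lemma energy_upper (R : realType) (n : nat) (p alpha beta A : R) (f Q : R -> R)
    (B x y : R) :
  (0 < n)%N -> 1 < p -> 0 < alpha -> 0 < beta -> 0 < A ->
  (forall X, profile n p alpha beta A f Q X) ->
  (forall xi, 0 <= xi -> - Q xi <= B) -> 1 <= x -> x <= y ->
  energy p alpha beta f Q y + (B * f y `^ (p - 1) + n%:R / p * f y `^ p) / beta
  <= energy p alpha beta f Q x
     + (B * f x `^ (p - 1) + n%:R / p * f x `^ p) / beta.
Proof.
move=> n0 p1 a0 b0 A0 pr QB x1 xy; rewrite -lerN2.
have p0 : 0 < p by rewrite (lt_trans ltr01).
pose F z := - (energy p alpha beta f Q z
  + beta^-1 * (B * f z `^ (p - 1) + n%:R / p * f z `^ p)).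
pose dF z := - (((p - 1) * f z `^ (p - 1) / f z * z * Q z ^+ 2
      - n%:R * (f z `^ (p - 1) * Q z) / z) / beta
  + beta^-1 * (B * ((p - 1) * f z `^ (p - 1 - 1) * (z * Q z))
  + n%:R / p * (p * f z `^ (p - 1) * (z * Q z)))).
suff : F x <= F y by rewrite /F ![beta^-1 * _]mulrC.
have x0 : 0 < x by rewrite (lt_le_trans ltr01).
have dFz z : x <= z <= y -> is_derive z 1 F (dF z).
  move=> /andP[xz zy].
  have zX : 0 < z < z + 1 by rewrite (lt_le_trans x0 xz) ltrDl ltr01.
  have f0 : 0 < f z by apply: (prof_gt0 (pr (z + 1))); case/andP: zX => /ltW -> ->.
  have df := prof_derive (pr (z + 1)) zX.
  have D1 := is_derive_powR_fun (p - 1) df f0.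
  have D2 := is_derive_powR_fun p df f0.
  have DE := is_derive_energy b0 (pr (z + 1)) zX.
  exact: is_deriveN_fun (is_deriveD_fun DE (is_deriveZ_fun _
    (is_deriveD_fun (is_deriveZ_fun _ D1) (is_deriveZ_fun _ D2)))).
apply: (ge0_derive_le xy (df := dF)).
- by move=> z /dFz; exact: is_derive_continuous.
- by move=> z /andP[/ltW xz /ltW zy]; apply: dFz; rewrite xz.
move=> z /andP[/ltW xz _].
have z0 : 0 < z := lt_le_trans x0 xz.
have zX : 0 <= z < z + 1 by rewrite ltW//= ltrDl ltr01.
have f0 := prof_gt0 (pr (z + 1)) zX.
have Q0 := profile_Q_lt0 n0 a0 A0 (pr (z + 1)) zX.
have QBz := QB z (ltW z0).
rewrite /dF (powR_pred (p - 1) f0).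
set G := f z `^ (p - 1); have G0 : 0 < G by rewrite powR_gt0.
have -> : - (((p - 1) * G / f z * z * Q z ^+ 2 - n%:R * (G * Q z) / z) / beta
  + beta^-1 * (B * ((p - 1) * (G / f z) * (z * Q z))
     + n%:R / p * (p * G * (z * Q z)))) =
   ((p - 1) * G / f z * z * (- Q z) * (B + Q z) +
    n%:R * G * (- Q z) * (z - z^-1)) / beta.
  by field; rewrite !gt_eqF.
have nQ : 0 <= - Q z by rewrite oppr_ge0 ltW.
rewrite divr_ge0 ?(ltW b0)// addr_ge0// mulr_ge0//.
- rewrite mulr_ge0// mulr_ge0 ?(ltW z0)// divr_ge0 ?(ltW f0)//.
  by rewrite mulr_ge0 ?(ltW G0)// subr_ge0 ltW.
- by rewrite addrC -lerBlDr sub0r; lra.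
- by rewrite mulr_ge0// mulr_ge0 ?(ltW G0).
- rewrite subr_ge0; have z1 : 1 <= z by exact: le_trans xz.
  by rewrite (le_trans _ z1)// invf_le1.
Qed.

(** Suppose Q = - B at Y. If Y >= 1, the term beta Y^2 B / f dominates alpha because beta B >= alpha
    A >= alpha f. If Y < 1, then f Y >= f 1 and n B exceeds alpha f(Y)^(1-p). In both cases Q' > 0
    at Y, so B + Q has no first zero. *)
Lemma profile_Q_bounded (R : realType) (n : nat) (p alpha beta A : R)
    (f Q : R -> R) :
  (0 < n)%N -> 1 < p -> 0 < alpha -> 0 < beta -> 0 < A ->
  (forall X, profile n p alpha beta A f Q X) ->
  exists B, forall xi, 0 <= xi -> - Q xi <= B.
Proof.
move=> n0 p1 a0 b0 A0 pr.
have nR : 0 < n%:R :> R by rewrite ltr0n.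
have f1 : 0 < f 1 by apply: (prof_gt0 (pr 2)); rewrite ler01 ltr1n.
(* The first two summands serve the cases Y >= 1 and Y < 1, and the last one is - Q 0. *)
pose B := alpha * A / beta + alpha * f 1 `^ (1 - p) / n%:R + 1
  + alpha / n%:R * A `^ (1 - p).
have t1 : 0 < alpha * A / beta by rewrite divr_gt0 ?mulr_gt0.
have t2 : 0 < alpha * f 1 `^ (1 - p) / n%:R.
  by rewrite divr_gt0 ?mulr_gt0 ?powR_gt0.
have t3 : 0 < alpha / n%:R * A `^ (1 - p) by rewrite mulr_gt0 ?powR_gt0 ?divr_gt0.
have B0 : 0 < B by rewrite /B; lra.
exists B => xi xi0.
suff : 0 < B + Q xi by lra.
apply: (@pos_propagate_derive R (fun y => B + Q y) xi); last by rewrite xi0 lexx.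
- by move=> y _; apply: cvgD; [exact: cvg_cst|exact: (prof_contQ (pr 0))].
- by rewrite (prof_initQ (pr 0)) /B; lra.
move=> Y /andP[Y0 Yx] _ E.
have YX : 0 < Y < Y + 1 by rewrite Y0 ltrDl ltr01.
have YX' : 0 <= Y < Y + 1 by rewrite ltW//= ltrDl ltr01.
have D := prof_deriveQ (pr (Y + 1)) YX.
eexists; last exact: is_deriveD_fun (is_derive_cst B Y 1) D.
have f0 := prof_gt0 (pr (Y + 1)) YX'.
have fA := profile_le n0 a0 A0 (pr (Y + 1)) YX'.
have QY : Q Y = - B by lra.
rewrite add0r divr_gt0// /flux QY powRN (powR_succ p f0) powR_opp_pred.
set G := f Y `^ (p - 1); have G0 : 0 < G by rewrite powR_gt0.
have -> : - (beta * Y ^+ 2 * (G * f Y)^-1 * - B) - alpha * G^-1 - n%:R * - B =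
  (beta * Y ^+ 2 * B / f Y - alpha) / G + n%:R * B.
  by field; rewrite !gt_eqF.
have nB : 0 < n%:R * B by rewrite mulr_gt0.
have [Y1|Y1] := leP 1 Y.
  rewrite ltr_wpDl// divr_ge0 ?(ltW G0)// subr_ge0 ler_pdivlMr//.
  have bB : alpha * A <= beta * B.
    rewrite mulrC -[beta * B]mulrC -ler_pdivrMr// [A * _]mulrC /B; lra.
  rewrite (le_trans (_ : _ <= alpha * A)) ?ler_pM2l//.
  rewrite (le_trans bB)// mulrAC ler_peMr ?mulr_ge0 ?(ltW b0) ?(ltW B0)//.
  exact: exprn_ege1.
rewrite mulrBl -addrA ltr_wpDl//.
  by rewrite divr_ge0 ?(ltW G0)// divr_ge0 ?(ltW f0)// !mulr_ge0 ?sqr_ge0 ?ltW.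
rewrite addrC subr_gt0.
have fY : f 1 <= f Y.
  rewrite -lerN2.
  apply: (@ge0_derive_le R (fun y => - f y) (fun y => - (y * Q y)) Y 1 (ltW Y1)).
  - by move=> y _; apply: cvgN; exact: (prof_cont (pr 0)).
  - move=> y /andP[y0 yx]; apply: is_deriveN_fun; apply: (prof_derive (pr (y + 1))).
    by rewrite (lt_trans Y0 y0) ltrDl ltr01.
  move=> y /andP[/(lt_trans Y0) y0 yx].
  rewrite oppr_ge0 mulr_ge0_le0 ?(ltW y0)// ltW//.
  by apply: (profile_Q_lt0 n0 a0 A0 (pr (y + 1))); rewrite ltW//= ltrDl ltr01.
have GG : f 1 `^ (p - 1) <= G.
  by apply: ge0_ler_powR; rewrite ?nnegrE ?subr_ge0 ?(ltW f0) ?(ltW f1) ?(ltW p1).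
rewrite (@le_lt_trans _ _ (alpha * f 1 `^ (1 - p)))//.
  by rewrite powR_opp_pred ler_pM2l// lef_pV2 ?posrE ?powR_gt0.
rewrite -ltr_pdivrMl// [n%:R^-1 * _]mulrC /B; lra.
Qed.

Lemma profile_upper (R : realType) (n : nat) (p alpha beta A : R)
    (f Q : R -> R) :
  (0 < n)%N -> 1 < p -> 0 < alpha -> 0 < beta -> 0 < A ->
  (forall X, profile n p alpha beta A f Q X) ->
  exists2 C, 0 < C & forall xi, 0 <= xi ->
    f xi <= C * (1 + xi) `^ (- (alpha / beta)).
Proof.
move=> n0 p1 a0 b0 A0 pr.
have [B QB] := profile_Q_bounded n0 p1 a0 b0 A0 pr.
have dom (xi : R) : 0 <= xi -> 0 <= xi < xi + 1 by move=> ->; rewrite ltrDl ltr01.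
have f0 (xi : R) (h : 0 <= xi) := prof_gt0 (pr (xi + 1)) (dom xi h).
have Bge : 0 <= B.
  by rewrite (le_trans _ (QB 0 (lexx 0)))// oppr_ge0 ltW//;
     apply: (profile_Q_lt0 n0 a0 A0 (pr 1)); rewrite lexx ltr01.
have ab0 : 0 < alpha / beta by rewrite divr_gt0.
have p0 : 0 < p by rewrite (lt_trans ltr01).
(* The value at 1 of the nonincreasing function of [energy_upper], plus kappa / beta to discard the
   last term of the energy at xi. *)
pose E1 := energy p alpha beta f Q 1
     + (B * f 1 `^ (p - 1) + n%:R / p * f 1 `^ p) / beta
     + kappa n alpha / beta.
have far xi : 1 <= xi -> alpha / beta * ln xi + ln (f xi) <= E1.
  move=> x1; have x0 : 0 <= xi by rewrite (le_trans _ x1).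
  have := energy_upper n0 p1 a0 b0 A0 pr QB (lexx 1) x1.
  have h : 0 <= (B * f xi `^ (p - 1) + n%:R / p * f xi `^ p) / beta.
    rewrite divr_ge0 ?(ltW b0)// addr_ge0// mulr_ge0 ?powR_ge0//.
    by rewrite divr_ge0 ?(ltW p0).
  have S := profile_slope_lt n0 p1 a0 b0 A0 (pr (xi + 1)) (dom xi x0).
  have h2 : - (kappa n alpha / beta) <= f xi `^ (p - 1) * Q xi / beta.
    by rewrite -mulNr ler_pM2r ?invr_gt0//; lra.
  rewrite /E1 /energy in h h2 *; lra.
(* On [0, 1] the bound A suffices, and beyond 1 the bound on the energy gives exp E1. The power of 2
   compensates (1 + xi)^(- alpha / beta) in the first case and the passage from xi to 1 + xi <= 2 xi
   in the second. *)
exists (Num.max A (expR E1) * 2 `^ (alpha / beta)).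
  by rewrite mulr_gt0 ?powR_gt0// lt_max A0.
move=> xi x0.
have t0 : 0 < 1 + xi by rewrite ltr_pwDl.
have [x1|x1] := leP xi 1.
  rewrite (le_trans (profile_le n0 a0 A0 (pr (xi + 1)) (dom xi x0)))//.
  rewrite -mulrA (le_trans (_ : _ <= Num.max A (expR E1)))//.
    by rewrite le_max lexx.
  rewrite ler_peMr ?le_max ?(ltW A0)// powRN ler_pdivlMr ?powR_gt0// mul1r.
  by apply: ge0_ler_powR; rewrite ?nnegrE ?(ltW ab0) ?(ltW t0)//; lra.
have xp : 0 < xi by rewrite (lt_trans ltr01).
have fx := f0 xi x0.
rewrite (le_trans (_ : _ <= expR E1 * 2 `^ (alpha / beta) *
    (1 + xi) `^ (- (alpha / beta))))//; last first.
  by rewrite !ler_pM2r ?powR_gt0// le_max lexx orbT.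
rewrite -ler_ln ?posrE ?mulr_gt0 ?expR_gt0 ?powR_gt0//.
rewrite !lnM ?posrE ?mulr_gt0 ?expR_gt0 ?powR_gt0// expRK !ln_powR.
have := far xi (ltW x1).
have : alpha / beta * ln (1 + xi) <= alpha / beta * (ln 2 + ln xi).
  rewrite ler_pM2l// -lnM ?posrE// ler_ln ?posrE ?mulr_gt0//; lra.
lra.
Qed.

(** * The Volterra equation *)

Lemma continuous_maxr (R : realType) (f g : R -> R) :
  continuous f -> continuous g -> continuous (fun x => Num.max (f x) (g x)).
Proof.
move=> cf cg.
have -> : (fun x => Num.max (f x) (g x)) =
    (fun x => (f x + g x + `|f x - g x|) / 2).
  by apply/funext => x; rewrite maxr_absE.
move=> x; apply: cvgM; last exact: cvg_cst.
apply: cvgD; first by apply: cvgD; [exact: cf|exact: cg].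
by apply: cvg_norm; apply: cvgB; [exact: cf|exact: cg].
Qed.

Lemma maxr_lipschitz (R : realType) (x y m : R) :
  `|Num.max x m - Num.max y m| <= `|x - y|.
Proof.
have := ler_norm (x - y); have := ler_norm (- (x - y)); rewrite normrN.
have := normr_ge0 (x - y).
rewrite ler_norml /Num.max; case: ltP => ?; case: ltP => ?; move=> *;
  apply/andP; split; lra.
Qed.

(** With k the largest absolute slope of z^(1-p) on [m, +oo), attained at m, the function z^(1-p) is
    nonincreasing and z^(1-p) + k z is nondecreasing. *)
Lemma powR_lipschitz (R : realType) (p m x y : R) : 1 < p -> 0 < m ->
  m <= x -> m <= y ->
  `|x `^ (1 - p) - y `^ (1 - p)| <= (p - 1) * m `^ (- p) * `|x - y|.
Proof.
move=> p1 m0; wlog xy : x y / x <= y.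
  move=> H mx my; have [|/ltW] := leP x y => h; first exact: H.
  by rewrite distrC [`|x - y|]distrC; apply: H.
move=> mx my; have x0 : 0 < x by exact: lt_le_trans mx.
have pos t : x <= t -> 0 < t by exact: lt_le_trans.
have d t : x <= t -> is_derive t 1 (fun z : R => z `^ (1 - p)) ((1 - p) * t `^ (- p)).
  move=> /pos t0; have -> : t `^ (- p) = t `^ (1 - p - 1) by congr (_ `^ _); lra.
  exact: is_derive1_powR.
pose k := (p - 1) * m `^ (- p).
have dk t : x <= t -> 0 <= (1 - p) * t `^ (- p) + k.
  move=> xt; have t0 := pos t xt.
  suff : (p - 1) * t `^ (- p) <= k by lra.
  rewrite ler_pM2l ?subr_gt0// !powRN lef_pV2 ?posrE ?powR_gt0//.
  apply: ge0_ler_powR; rewrite ?nnegrE ?(ltW t0) ?(ltW m0)//; first lra.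
  exact: le_trans mx xt.
have w t : x < t < y -> x <= t by case/andP=> /ltW.
have h1 : - y `^ (1 - p) >= - x `^ (1 - p).
  apply: (@ge0_derive_le R (fun z => - z `^ (1 - p))
     (fun z => - ((1 - p) * z `^ (- p))) x y xy).
  - move=> t /andP[/d dt _]; exact: is_derive_continuous (is_deriveN_fun dt).
  - by move=> t /w /d dt; exact: is_deriveN_fun.
  - move=> t _; rewrite -mulNr mulr_ge0 ?powR_ge0//; lra.
have h2 : x `^ (1 - p) + k * x <= y `^ (1 - p) + k * y.
  have dd t : x <= t -> is_derive t 1 (fun z => z `^ (1 - p) + k * z)
      ((1 - p) * t `^ (- p) + k * 1).
    move=> /d dt; exact: is_deriveD_fun dt (is_deriveZ_fun k (is_derive_id t 1)).
  apply: (@ge0_derive_le R (fun z => z `^ (1 - p) + k * z)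
     (fun z => (1 - p) * z `^ (- p) + k * 1) x y xy).
  - by move=> t /andP[/dd dt _]; exact: is_derive_continuous dt.
  - by move=> t /w /dd.
  - by move=> t /w /dk; rewrite mulr1.
rewrite ger0_norm ?subr_ge0; last by lra.
rewrite ler0_norm ?subr_le0// -/k; lra.
Qed.

Lemma exists_half_pow_le (R : realType) (M e : R) : 0 < e ->
  exists k : nat, M / 2 ^+ k <= e.
Proof.
move=> e0; exists (Num.Def.archi_bound `|M / e|).
set k := Num.Def.archi_bound _.
rewrite ler_pdivrMr ?exprn_gt0// mulrC -ler_pdivrMr//.
apply: (le_trans (ler_norm _)).
apply: (le_trans (ltW (archi_boundP (normr_ge0 _)))).
by rewrite -natrX ler_nat; apply: ltnW; apply: ltn_expl.
Qed.

(* The limit is the supremum of the nondecreasing sequence [u k - 2 M / 2^k]. *)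
Lemma geometric_limit (R : realType) (u : nat -> R) (M : R) : 0 <= M ->
  (forall k, `|u k.+1 - u k| <= M / 2 ^+ k) ->
  exists l, forall k, `|l - u k| <= 2 * M / 2 ^+ k.
Proof.
move=> M0 hu.
pose lo k := u k - 2 * M / 2 ^+ k.
pose hi k := u k + 2 * M / 2 ^+ k.
have half k : 2 * M / 2 ^+ k.+1 = M / 2 ^+ k.
  by rewrite exprS invfM mulrACA mulfV// mul1r.
have dbl k : 2 * M / 2 ^+ k = 2 * (M / 2 ^+ k) by rewrite mulrA.
have loS : {homo lo : i j / (i <= j)%N >-> i <= j}.
  apply: (@homo_leq _ lo (fun x y => x <= y)); first by [].
    by move=> ? ? ?; exact: le_trans.
  move=> k; rewrite /lo half dbl; have := hu k; rewrite ler_norml => /andP[]; lra.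
have hiS : {homo hi : i j / (i <= j)%N >-> j <= i}.
  apply: (@homo_leq _ hi (fun x y => y <= x)); first by [].
    by move=> ? ? ? h1 h2; exact: le_trans h2 h1.
  move=> k; rewrite /hi half dbl; have := hu k; rewrite ler_norml => /andP[]; lra.
have lohi i j : lo i <= hi j.
  rewrite (le_trans (loS i (maxn i j) (leq_maxl _ _)))//.
  rewrite (le_trans _ (hiS j (maxn i j) (leq_maxr _ _)))// /lo /hi.
  have : 0 <= 2 * M / 2 ^+ maxn i j by rewrite !mulr_ge0 ?invr_ge0 ?exprn_ge0.
  lra.
pose S := range lo.
have hS : has_sup S.
  by split; [exists (lo 0%N); exists 0%N|exists (hi 0%N) => _ [i _ <-]].
exists (sup S) => k.
have h1 : lo k <= sup S by apply: ub_le_sup hS.2 _ _; exists k.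
have h2 : sup S <= hi k by apply: ge_sup; [exact: hS.1|move=> _ [i _ <-]].
rewrite ler_norml; apply/andP; split; move: h1 h2; rewrite /lo /hi; lra.
Qed.

Lemma left_limit_ge0 (R : realType) (h : R -> R) (X : R) :
  {for X, continuous h} -> 0 < X -> (forall y, 0 <= y < X -> 0 <= h y) ->
  0 <= h X.
Proof.
move=> ch X0 h0; rewrite leNgt; apply/negP => hX.
have /cvgr_lt /(_ _ hX) := ch; rewrite near_nbhs => -[e /= e0 he].
pose s := Num.max 0 (X - e / 2).
have sX : 0 <= s < X by rewrite /s le_max lexx /= gt_max X0 gtrBl divr_gt0.
have := h0 s sX; rewrite leNgt => /negP; apply; apply: he => /=.
case/andP: sX => s0 sX; rewrite gtr0_norm ?subr_gt0//.
have : X - e / 2 <= s by rewrite /s le_max lexx orbT.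
lra.
Qed.

(** * The integral operator and its relation to profiles *)

Section operator.
Context (R : realType) (n : nat) (p alpha beta A : R).
Context (n_gt0 : (0 < n)%N) (p_gt1 : 1 < p) (alpha_gt0 : 0 < alpha)
  (beta_gt0 : 0 < beta) (A_gt0 : 0 < A).

Let nR : 0 < n%:R :> R. Proof. by rewrite ltr0n. Qed.
Let p_gt0 : 0 < p. Proof. by rewrite (lt_trans ltr01). Qed.
Let p1_gt0 : 0 < p - 1. Proof. by rewrite subr_gt0. Qed.

(* f'/xi in terms of [w = f^(1-p)], after the integration by parts. *)
Definition slope (w : R -> R) (xi : R) : R :=
  beta / (p - 1) * w xi
  - (n%:R * (beta / (p - 1)) + alpha) * average n w `|xi|.

(** The substitution q = s^2 turns s Q(s) ds into [half_slope] dq. Thus [integrate_slope] is A plus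
    the integral of s Q(s) from 0 to xi, presented as a C^1 function of xi^2: it is even, and smooth
    enough at the origin of R^n. *)
Definition half_slope (w : R -> R) (q : R) : R := slope w (Num.sqrt q) / 2.

Definition integrate_slope (w : R -> R) (xi : R) : R :=
  A + primitive (half_slope w) (xi ^+ 2).

Lemma slope_continuous (w : R -> R) : continuous w -> continuous (slope w).
Proof.
move=> cw; suff ca : continuous (fun x : R => average n w `|x|).
  move=> x; apply: cvgB; first by apply: cvgM; [exact: cvg_cst|exact: cw].
  by apply: cvgM; [exact: cvg_cst|exact: ca].
move=> x; have -> : (fun x : R => average n w `|x|) =
    (fun x => average n w (Num.sqrt (x ^+ 2))).
  by apply/funext => y; rewrite sqrtr_sqr.
apply: (@continuous_comp _ _ _ (fun x : R => x ^+ 2)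
  (fun q => average n w (Num.sqrt q))).
  exact: exprn_continuous.
exact: average_sqrt_continuous.
Qed.

Lemma half_slope_continuous (w : R -> R) : continuous w -> continuous (half_slope w).
Proof.
move=> cw x; apply: cvgM; last exact: cvg_cst.
apply: (@continuous_comp _ _ _ (@Num.sqrt R) (slope w)).
  exact: sqrt_continuous.
exact: slope_continuous.
Qed.

Lemma is_derive_half_slope (w : R -> R) (q : R) : continuous w -> -1 < q ->
  is_derive q 1 (primitive (half_slope w)) (half_slope w q).
Proof. by move=> cw; apply: is_derive_primitive; exact: half_slope_continuous. Qed.

Lemma is_derive_integrate_slope (w : R -> R) (xi : R) : continuous w -> 0 <= xi ->
  is_derive xi 1 (integrate_slope w) (xi * slope w xi).
Proof.
move=> cw x0.
have q1 : -1 < xi ^+ 2 by rewrite (lt_le_trans _ (sqr_ge0 xi))// ltrN10.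
have D := is_derive_comp_fun (is_deriveXn 2 xi) (is_derive_half_slope cw q1).
apply: (is_derive_cast (is_deriveD_fun (is_derive_cst A xi 1) D)).
by rewrite /half_slope sqrtr_sqr ger0_norm// expr1; field.
Qed.

Lemma integrate_slope_continuous (w : R -> R) : continuous w ->
  continuous (integrate_slope w).
Proof.
move=> cw x; apply: cvgD; first exact: cvg_cst.
apply: (@continuous_comp _ _ _ (fun x : R => x ^+ 2) (primitive (half_slope w))).
  exact: exprn_continuous.
apply: (is_derive_continuous (is_derive_half_slope cw _)).
by rewrite (lt_le_trans _ (sqr_ge0 x))// ltrN10.
Qed.

(** With a the average of w and c = n b + alpha, Q = b w - c a and xi a' = w - n a give xi Q' = b xi
    w' - alpha w - n Q. Inserting w = f^(1-p), f' = xi Q and b (p - 1) = beta yields [flux]. *)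
Lemma profile_slope (f w : R -> R) (X : R) : continuous w -> f = integrate_slope w ->
  w 0 = A `^ (1 - p) ->
  (forall xi, 0 <= xi < X -> 0 < f xi /\ w xi = f xi `^ (1 - p)) ->
  profile n p alpha beta A f (slope w) X.
Proof.
move=> cw fE w0 fw; split.
- by rewrite fE; exact: integrate_slope_continuous.
- exact: slope_continuous.
- by rewrite fE /integrate_slope expr0n /= primitive0 addr0.
- by rewrite /slope normr0 /average eqxx w0; field; rewrite !gt_eqF.
- by move=> xi /fw[].
- by move=> xi /andP[/ltW x0 _]; rewrite {1}fE; exact: is_derive_integrate_slope.
move=> xi xX; have /andP[x0 x1] := xX.
have [f0 wx] : 0 < f xi /\ w xi = f xi `^ (1 - p) by apply: fw; rewrite ltW.
have df : is_derive xi 1 f (xi * slope w xi).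
  by rewrite {1}fE; exact: is_derive_integrate_slope (ltW x0).
have dw : is_derive xi 1 w ((1 - p) * f xi `^ (1 - p - 1) * (xi * slope w xi)).
  apply: (near_eq_is_derive _ (is_derive_powR_fun (1 - p) df f0)).
  near=> y; have [] // := fw y.
  apply/andP; split; last by near: y; exact: lt_nbhsl.
  by apply: ltW; near: y; exact: lt_nbhsr.
have da := is_derive_average n_gt0 cw x0.
apply: (@near_eq_is_derive _ _ _ (fun y => beta / (p - 1) * w y
  - (n%:R * (beta / (p - 1)) + alpha) * average n w y)).
  near=> y; rewrite /slope ger0_norm//; apply: ltW; near: y; exact: lt_nbhsr.
apply: (is_derive_cast (is_deriveB_fun (is_deriveZ_fun _ dw) (is_deriveZ_fun _ da))).
have -> : 1 - p - 1 = - p by lra.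
rewrite /flux /slope wx (gtr0_norm x0).
by field; rewrite !gt_eqF.
Unshelve. all: by end_near.
Qed.

End operator.

(** * Truncation, Picard iteration and uniqueness *)

Section picard.
Context (R : realType) (n : nat) (p alpha beta A : R).
Context (n_gt0 : (0 < n)%N) (p_gt1 : 1 < p) (alpha_gt0 : 0 < alpha)
  (beta_gt0 : 0 < beta) (A_gt0 : 0 < A).

Let nR : 0 < n%:R :> R. Proof. by rewrite ltr0n. Qed.
Let p_gt0 : 0 < p. Proof. by rewrite (lt_trans ltr01). Qed.
Let p1_gt0 : 0 < p - 1. Proof. by rewrite subr_gt0. Qed.
Let b : R := beta / (p - 1).
Let b_gt0 : 0 < b. Proof. exact: divr_gt0. Qed.
Let c : R := n%:R * b + alpha.
Let c_gt0 : 0 < c. Proof. by rewrite /c addr_gt0// mulr_gt0. Qed.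
Let m := floor_fun n p alpha beta A.
Let m_gt0 xi : 0 < m xi. Proof. exact: floor_fun_gt0. Qed.
Let A4_lt : A / 4 < A.
Proof. by rewrite gtr_pMr// invf_lt1// ltr1n. Qed.
Let ab_gt0 : 0 < alpha / beta. Proof. exact: divr_gt0. Qed.

Lemma floor_fun_continuous : continuous m.
Proof.
move=> x; apply: cvgM; first exact: cvg_cst.
have x0 : 0 < 1 + `|x| by rewrite ltr_pwDl.
apply: (@continuous_comp _ _ _ (fun y : R => 1 + `|y|)
  (fun z => z `^ (- (alpha / beta)))).
  by apply: cvgD; [exact: cvg_cst|apply: cvg_norm; exact: cvg_id].
exact: is_derive_continuous (is_derive1_powR _ x0).
Qed.

Lemma floor_fun_nincr (s xi : R) : 0 <= s -> s <= xi -> m xi <= m s.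
Proof.
move=> s0 sx; rewrite /m /floor_fun ler_pM2l ?floor_coef_gt0//.
have x0 := le_trans s0 sx.
rewrite !powRN lef_pV2 ?posrE ?powR_gt0 ?ltr_pwDl//.
by apply: ge0_ler_powR; rewrite ?nnegrE ?(ltW ab_gt0) ?addr_ge0// !ger0_norm//
  lerD2l.
Qed.

(** The barrier lies below A, so the truncation is inactive at 0 and on the constant first iterate
    A. *)
Lemma floor_fun_le xi : m xi <= A / 4.
Proof.
have a0 := ltW ab_gt0; have r0 := near_radius_gt0 n_gt0 p_gt1 alpha_gt0 A_gt0.
have x1 : 0 < 1 + `|xi| by rewrite ltr_pwDl.
rewrite /m /floor_fun /floor_coef -!mulrA ler_pM2l//.
rewrite ler_piMr ?invr_ge0//.
rewrite !mulr_ile1 ?mulr_ge0 ?expR_ge0 ?powR_ge0//.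
- rewrite -[leRHS](@expR0 R) ler_expR oppr_le0 divr_ge0 ?(ltW beta_gt0)//.
  by rewrite ltW// kappa_gt0.
- rewrite -[leRHS](powRr0 (near_radius n p alpha A)) ger_powR//.
  by rewrite r0 /near_radius ge_min lexx.
rewrite powRN invf_le1 ?powR_gt0// -[leLHS](powRr0 (1 + `|xi|)).
by rewrite ler_powR// lerDl.
Qed.

(** The maximum with m keeps the base in [m xi, +oo), where z^(1-p) is Lipschitz. The constant may
    grow with xi, because m decays; the weight [growth] compensates for this. *)
Definition truncated (f : R -> R) (xi : R) : R :=
  Num.max (f xi) (m xi) `^ (1 - p).

Lemma truncated_continuous (f : R -> R) : continuous f -> continuous (truncated f).
Proof.
move=> cf x.
apply: (@continuous_comp _ _ _ (fun y => Num.max (f y) (m y))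
  (fun z => z `^ (1 - p))).
  exact: continuous_maxr cf floor_fun_continuous x.
by apply: (is_derive_continuous (is_derive1_powR _ _)); rewrite lt_max m_gt0 orbT.
Qed.

Definition lipschitz (xi : R) : R := (p - 1) * m xi `^ (- p).

Lemma lipschitz_ge0 xi : 0 <= lipschitz xi.
Proof. by rewrite mulr_ge0 ?powR_ge0 ?ltW. Qed.

Lemma lipschitz_continuous : continuous lipschitz.
Proof.
move=> x; apply: cvgM; first exact: cvg_cst.
apply: (@continuous_comp _ _ _ m (fun z => z `^ (- p))).
  exact: floor_fun_continuous.
exact: is_derive_continuous (is_derive1_powR _ (m_gt0 x)).
Qed.

Lemma lipschitz_ndecr (s xi : R) : 0 <= s -> s <= xi -> lipschitz s <= lipschitz xi.
Proof.
move=> s0 sx; have := floor_fun_nincr s0 sx.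
have := m_gt0 s; have := m_gt0 xi; rewrite /lipschitz.
move: (m xi) (m s) => y z y0 z0 yz.
rewrite ler_pM2l// !powRN lef_pV2 ?posrE ?powR_gt0//.
by apply: ge0_ler_powR; rewrite ?nnegrE ?(ltW p_gt0) ?(ltW y0) ?(ltW z0).
Qed.

Lemma truncated_dist (f g : R -> R) (xi : R) :
  `|truncated f xi - truncated g xi| <= lipschitz xi * `|f xi - g xi|.
Proof.
apply: le_trans (powR_lipschitz p_gt1 (m_gt0 xi) _ _) _.
- by rewrite le_max lexx orbT.
- by rewrite le_max lexx orbT.
- by rewrite ler_wpM2l ?lipschitz_ge0// maxr_lipschitz.
Qed.

(* [growth] solves V' = (1 + (b + c / n) * lipschitz) V, so that the Picard
   operator halves the norm sup |f| / V(xi^2) on the whole half-line. *)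
Definition rate (q : R) : R := (b + c / n%:R) * lipschitz (Num.sqrt q) + 1.

Definition growth (q : R) : R := expR (primitive rate q).

Let bc_gt0 : 0 < b + c / n%:R. Proof. by rewrite addr_gt0// divr_gt0. Qed.

Lemma rate_ge1 q : 1 <= rate q.
Proof. by rewrite lerDr mulr_ge0 ?lipschitz_ge0 ?(ltW bc_gt0). Qed.

Lemma rate_continuous : continuous rate.
Proof.
move=> q; apply: cvgD; last exact: cvg_cst.
apply: cvgM; first exact: cvg_cst.
apply: (@continuous_comp _ _ _ (@Num.sqrt R) lipschitz).
  exact: sqrt_continuous.
exact: lipschitz_continuous.
Qed.

Let ge0_gtN1 (q : R) : 0 <= q -> -1 < q.
Proof. by apply: lt_le_trans; rewrite ltrN10. Qed.

Lemma is_derive_growth (q : R) : 0 <= q -> is_derive q 1 growth (growth q * rate q).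
Proof.
move=> /ge0_gtN1 q1; have D := is_derive_primitive rate_continuous q1.
exact: is_derive_comp_fun D (is_derive_expR _).
Qed.

Lemma growth_ndecr (q r : R) : 0 <= q -> q <= r -> growth q <= growth r.
Proof.
move=> q0 qr; apply: (ge0_derive_le qr (df := fun y => growth y * rate y)).
- move=> y /andP[qy _].
  exact: is_derive_continuous (is_derive_growth (le_trans q0 qy)).
- move=> y /andP[/ltW qy _]; exact: is_derive_growth (le_trans q0 qy).
- move=> y _; rewrite mulr_ge0 ?expR_ge0//.
  exact: le_trans (ler01) (rate_ge1 y).
Qed.

Lemma growth_gt0 q : 0 < growth q. Proof. exact: expR_gt0. Qed.

Lemma growth_ge1 (q : R) : 0 <= q -> 1 <= growth q.
Proof.
by move=> q0; rewrite (le_trans _ (growth_ndecr (lexx 0) q0))// /growth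
  primitive0 expR0.
Qed.

Lemma slope_dist (w v : R -> R) (M xi : R) : continuous w -> continuous v ->
  0 <= xi -> (forall s, 0 <= s <= xi -> `|w s - v s| <= M) ->
  `|slope n p alpha beta w xi - slope n p alpha beta v xi|
    <= (b + c / n%:R) * M.
Proof.
move=> cw cv x0 wv; rewrite /slope -/b -/c (ger0_norm x0).
have h1 := wv xi; have h2 := average_dist n_gt0 cw cv x0 wv.
set aw := average n w xi in h2 *; set av := average n v xi in h2 *.
have -> : b * w xi - c * aw - (b * v xi - c * av) =
  b * (w xi - v xi) - c * (aw - av) by ring.
rewrite (le_trans (ler_normB _ _))// (normrM b) (normrM c).
rewrite (gtr0_norm b_gt0) (gtr0_norm c_gt0).
have -> : (b + c / n%:R) * M = b * M + c * (M / n%:R).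
  by move: b c => b' c'; ring.
apply: lerD; rewrite ler_pM2l//.
by apply: h1; rewrite x0 lexx.
Qed.

(** By [is_derive_growth] the hypothesis bounds the difference of slopes by K times the derivative
    of [growth]; the factor 1/2 comes from [half_slope]. The contribution of q = 0 has a favourable
    sign because the hypothesis at 0 forces K >= 0. *)
Lemma integrate_slope_dist (w v : R -> R) (K xi : R) :
  continuous w -> continuous v ->
  (forall q, 0 <= q ->
     `|slope n p alpha beta w (Num.sqrt q) - slope n p alpha beta v (Num.sqrt q)|
     <= K * (growth q * rate q)) ->
  `|integrate_slope n p alpha beta A w xi - integrate_slope n p alpha beta A v xi|
    <= K / 2 * growth (xi ^+ 2).
Proof.
move=> cw cv H.
pose D q := primitive (half_slope n p alpha beta w) q
  - primitive (half_slope n p alpha beta v) q.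
have -> : integrate_slope n p alpha beta A w xi - integrate_slope n p alpha beta A v xi
   = D (xi ^+ 2) - D 0.
  rewrite /integrate_slope /D (primitive0 (half_slope n p alpha beta w)).
  rewrite (primitive0 (half_slope n p alpha beta v)).
  move: (primitive _ (xi ^+ 2)) (primitive _ (xi ^+ 2)) => y z; ring.
apply: (@le_trans _ _ (K / 2 * growth (xi ^+ 2) - K / 2 * growth 0)).
  apply: (@normB_derive_le R D
    (fun q => half_slope n p alpha beta w q - half_slope n p alpha beta v q)
    (fun q => K / 2 * growth q) (fun q => K / 2 * (growth q * rate q))).
  - exact: sqr_ge0.
  - move=> y /andP[/ge0_gtN1 y1 _]; apply: is_deriveB_fun;
    exact: is_derive_half_slope.
  - by move=> y /andP[y0 _]; apply: is_deriveZ_fun; exact: is_derive_growth.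
  - move=> y /andP[y0 _]; rewrite /half_slope -mulrBl normrM.
    by rewrite (ger0_norm (x := 2^-1)) ?invr_ge0// mulrAC ler_pM2r ?invr_gt0// H.
rewrite gerBl mulr_ge0 ?(ltW (growth_gt0 _))// divr_ge0//.
have := H 0 (lexx 0); move/(le_trans (normr_ge0 _)).
rewrite pmulr_lge0// mulr_gt0 ?growth_gt0//.
exact: lt_le_trans (ltr01) (rate_ge1 0).
Qed.

Definition picard (f : R -> R) : R -> R :=
  integrate_slope n p alpha beta A (truncated f).

(** [lipschitz] and [growth] are nondecreasing, so on [0, sqrt q] the worst point is the right end.
    There (b + c / n) [lipschitz] <= [rate] bounds the difference of slopes by C times the
    derivative of [growth]. The conclusion covers negative xi as well, since [picard] depends on
    xi^2 only. *)
Lemma picard_contraction (f g : R -> R) (C : R) :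
  continuous f -> continuous g ->
  (forall s, 0 <= s -> `|f s - g s| <= C * growth (s ^+ 2)) ->
  forall xi, `|picard f xi - picard g xi| <= C / 2 * growth (xi ^+ 2).
Proof.
move=> cf cg fg xi.
have C0 : 0 <= C.
  have := fg 0 (lexx 0); move/(le_trans (normr_ge0 _)).
  by rewrite pmulr_lge0// growth_gt0.
apply: integrate_slope_dist; [exact: truncated_continuous..|].
move=> q q0; have s0 := sqrtr_ge0 q.
apply: (@le_trans _ _ ((b + c / n%:R) *
   (lipschitz (Num.sqrt q) * (C * growth q)))).
  apply: slope_dist; [exact: truncated_continuous..|by []|].
  move=> s /andP[s1 s2]; apply: (le_trans (truncated_dist f g s)).
  apply: ler_pM; [exact: lipschitz_ge0|exact: normr_ge0|exact: lipschitz_ndecr|].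
  apply: le_trans (fg s s1) _; apply: (ler_wpM2l C0); apply: growth_ndecr.
    exact: sqr_ge0.
  by rewrite -[leRHS](sqr_sqrtr q0) ler_pXn2r.
have -> : (b + c / n%:R) * (lipschitz (Num.sqrt q) * (C * growth q)) =
  C * (growth q * ((b + c / n%:R) * lipschitz (Num.sqrt q))) by ring.
by rewrite ler_wpM2l// ler_pM2l ?growth_gt0// lerDl.
Qed.

Lemma picard_continuous (f : R -> R) : continuous f -> continuous (picard f).
Proof.
move=> cf; apply: integrate_slope_continuous => //.
exact: truncated_continuous.
Qed.

(** The constant A is itself an image under [integrate_slope], namely that of w = 0. It is therefore
    enough to compare the truncated power of A with 0. *)
Lemma picard_start :
  exists2 C, 0 <= C & forall xi, `|picard (fun=> A) xi - A| <= C * growth (xi ^+ 2).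
Proof.
have cA : continuous (fun _ : R => A) by move=> x; exact: cst_continuous.
have c0 : continuous (fun _ : R => 0 : R) by move=> x; exact: cst_continuous.
pose M := A `^ (1 - p).
have z xi : 0 <= xi -> slope n p alpha beta (fun=> 0) xi = 0.
  by move=> x0; rewrite /slope average_cst// mul0r !mulr0 subr0.
have bM : 0 <= (b + c / n%:R) * M by rewrite mulr_ge0 ?powR_ge0 ?(ltW bc_gt0).
exists ((b + c / n%:R) * M / 2); first by rewrite divr_ge0.
move=> xi.
have E0 : A = integrate_slope n p alpha beta A (fun=> 0) xi.
  rewrite /integrate_slope.
  have := @normB_derive_le R (primitive (half_slope n p alpha beta (fun=> 0)))
    (half_slope n p alpha beta (fun=> 0)) (fun=> 0) (fun=> 0) (xi ^+ 2) (sqr_ge0 _).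
  rewrite primitive0 !subr0 => H.
  suff : `|primitive (half_slope n p alpha beta (fun=> 0)) (xi ^+ 2)| <= 0.
    by rewrite normr_le0 => /eqP ->; rewrite addr0.
  apply: H.
  - by move=> y /andP[/ge0_gtN1 y1 _]; exact: is_derive_half_slope.
  - by move=> y _; rewrite /half_slope z ?sqrtr_ge0// mul0r normr0.
rewrite [X in _ - X]E0.
apply: integrate_slope_dist => //; first exact: truncated_continuous cA.
move=> q q0; apply: (@le_trans _ _ ((b + c / n%:R) * M)).
  apply: slope_dist => //; first exact: truncated_continuous cA.
  move=> s _; rewrite subr0 ger0_norm ?powR_ge0// /truncated.
  by rewrite max_l// (le_trans (floor_fun_le s))// ltW.
rewrite ler_peMr// mulr_ege1 ?growth_ge1 ?rate_ge1//.
Qed.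

(** The iterates from A form a geometric Cauchy sequence at each point, with [growth] in the
    constant. The convergence is uniform on bounded intervals, so the limit is continuous, and the
    contraction property passes the fixed-point equation to the limit. *)
Lemma picard_fixpoint : exists2 f : R -> R, continuous f & f = picard f.
Proof.
have [C C0 hC] := picard_start.
pose F k := iter k picard (fun=> A).
have cF k : continuous (F k).
  elim: k => [|k IH]; first by move=> x; exact: cst_continuous.
  exact: picard_continuous.
have dF (k : nat) (xi : R) : `|F k.+1 xi - F k xi| <= C / 2 ^+ k * growth (xi ^+ 2).
  elim: k xi => [|k IH] xi; first by rewrite expr0 divr1; exact: hC.
  rewrite exprSr invfM mulrA.
  by apply: (picard_contraction (cF k.+1) (cF k)) => s _; exact: IH.
have lim (xi : R) : exists l, forall k,
    `|l - F k xi| <= 2 * (C * growth (xi ^+ 2)) / 2 ^+ k.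
  apply: geometric_limit; first by rewrite mulr_ge0 ?(ltW (growth_gt0 _)).
  by move=> k; rewrite mulrAC; exact: dF.
have [f hf] := choice lim.
have fF (k : nat) (xi : R) : `|f xi - F k xi| <= 2 * C / 2 ^+ k * growth (xi ^+ 2).
  by apply: (le_trans (hf xi k)); rewrite le_eqVlt; apply/orP; left; apply/eqP; ring.
have cf : continuous f.
  move=> x; apply/cvgrPdist_le => e e0.
  have e3 : 0 < e / 3 by rewrite divr_gt0.
  (* This k makes the distance to F k at most e / 3 throughout |y| <= |x| + 1, because [growth] is
     monotone. *)
  have [k hk] := exists_half_pow_le (2 * C * growth ((`|x| + 1) ^+ 2)) e3.
  have near_x y : `|y| <= `|x| + 1 -> `|f y - F k y| <= e / 3.
    move=> yx; apply: (le_trans (fF k y)).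
    have : growth (y ^+ 2) <= growth ((`|x| + 1) ^+ 2).
      apply: growth_ndecr; first exact: sqr_ge0.
      by rewrite -[y ^+ 2]real_normK ?num_real// ler_pXn2r ?nnegrE ?addr_ge0.
    move: (growth (y ^+ 2)) (growth ((`|x| + 1) ^+ 2)) hk => u v hk uv.
    apply: le_trans hk.
    by rewrite mulrAC ler_pM2r ?invr_gt0 ?exprn_gt0// ler_wpM2l ?mulr_ge0.
  have /cvgrPdist_le /(_ _ e3) H1 := cF k x.
  have H0 : \forall y \near x, `|x - y| <= 1.
    by have /cvgrPdist_le /(_ _ ltr01) := @cvg_id R (nbhs x).
  near=> y.
  have y1 : `|y| <= `|x| + 1.
    have -> : y = x - (x - y) by ring.
    rewrite (le_trans (ler_normB _ _))// lerD2l.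
    by near: y.
  have h1 : `|F k x - F k y| <= e / 3 by near: y.
  have h2 := near_x y y1.
  have h3 : `|f x - F k x| <= e / 3 by apply: near_x; rewrite lerDl.
  have -> : f x - f y = (f x - F k x) + (F k x - F k y) - (f y - F k y) by ring.
  rewrite (le_trans (ler_normB _ _))//.
  have := ler_normD (f x - F k x) (F k x - F k y); lra.
exists f => //; apply/funext => xi; apply/eqP; rewrite -subr_eq0 -normr_le0.
apply/ler_addgt0Pl => e e0; rewrite addr0.
have [k hk] := exists_half_pow_le (2 * C * growth (xi ^+ 2)) e0.
apply: le_trans hk.
(* Both distances to F k.+1 are bounded by half of the bound in [hk], so together they stay within
   it. *)
have h1 := fF k.+1 xi.
have h2 : `|F k.+1 xi - picard f xi| <= 2 * C / 2 ^+ k / 2 * growth (xi ^+ 2).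
  by rewrite distrC; apply: (picard_contraction cf (cF k)) => s _; exact: fF.
have -> : f xi - picard f xi =
    (f xi - F k.+1 xi) + (F k.+1 xi - picard f xi) by ring.
rewrite (le_trans (ler_normD _ _))// (le_trans (lerD h1 h2))//.
rewrite exprSr; set G := growth _; set P := 2 ^+ k.
have P0 : P != 0 by rewrite expf_neq0.
rewrite le_eqVlt; apply/orP; left; apply/eqP; field.
by [].
Unshelve. all: by end_near.
Qed.

(** As [growth] >= 1 on [0, +oo), a bounded difference has finite weighted norm, and repeated
    contraction halves it down to zero. *)
Lemma picard_unique (f g : R -> R) (C : R) :
  continuous f -> continuous g -> f = picard f -> g = picard g -> 0 <= C ->
  (forall s, 0 <= s -> `|f s - g s| <= C) -> f = g.
Proof.
move=> cf cg fE gE C0 fg.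
have H (k : nat) (xi : R) : 0 <= xi -> `|f xi - g xi| <= C / 2 ^+ k * growth (xi ^+ 2).
  elim: k xi => [|k IH] xi x0.
    by rewrite expr0 divr1 (le_trans (fg xi x0))// ler_peMr// growth_ge1// sqr_ge0.
  rewrite exprSr invfM mulrA [f xi](congr1 (@^~ xi) fE) [g xi](congr1 (@^~ xi) gE).
  exact: picard_contraction.
apply/funext => xi; apply/eqP; rewrite -subr_eq0 -normr_le0.
(* [H] covers xi >= 0; one more application of [picard] extends the estimate to every xi. *)
rewrite [f xi](congr1 (@^~ xi) fE) [g xi](congr1 (@^~ xi) gE).
apply/ler_addgt0Pl => e e0; rewrite addr0.
have [k hk] := exists_half_pow_le (C * growth (xi ^+ 2)) e0.
apply: le_trans hk; apply: le_trans (picard_contraction cf cg (H k) xi) _.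
rewrite [leRHS]mulrAC ler_pM2r ?growth_gt0// ler_pdivrMr// ler_peMr//; first last.
  by rewrite ler1n.
by rewrite divr_ge0 ?exprn_ge0.
Qed.

Lemma truncated_eq (f : R -> R) (xi : R) : m xi < f xi ->
  truncated f xi = f xi `^ (1 - p).
Proof. by move=> /ltW mf; rewrite /truncated max_l. Qed.

(** A continuation argument: as long as f > m the truncation is inactive, f is a profile and even f
    >= 2 m. At a first contact point X this would persist in the limit, giving f X >= 2 m X > m
    X. *)
Lemma picard_fixpoint_profile (f : R -> R) : continuous f -> f = picard f ->
  (forall xi, 0 <= xi -> m xi < f xi) /\
  forall X, profile n p alpha beta A f (slope n p alpha beta (truncated f)) X.
Proof.
move=> cf fE.
have f0 : f 0 = A.
  by rewrite fE /picard /integrate_slope expr0n /= primitive0 addr0.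
have m0 : m 0 < f 0 by rewrite f0 (le_lt_trans (floor_fun_le 0)).
have w0 : truncated f 0 = A `^ (1 - p) by rewrite truncated_eq// f0.
have P X : (forall xi, 0 <= xi < X -> m xi < f xi) ->
  profile n p alpha beta A f (slope n p alpha beta (truncated f)) X.
  move=> H; apply: profile_slope => //; first exact: truncated_continuous.
  move=> xi /H mf; split; last exact: truncated_eq.
  exact: lt_trans (m_gt0 xi) mf.
have mf xi : 0 <= xi -> m xi < f xi.
  move=> x0; suff : 0 < f xi - m xi by rewrite subr_gt0.
  have cfm : continuous (fun y => f y - m y).
    by move=> y; apply: cvgB; [exact: cf|exact: floor_fun_continuous].
  apply: (@pos_propagate R (fun y => f y - m y) xi); last by rewrite x0 lexx.
  - by move=> y _; exact: cfm.
  - by rewrite subr_gt0.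
  move=> X /andP[X0 _] HX.
  have pX : profile n p alpha beta A f (slope n p alpha beta (truncated f)) X.
    by apply: P => y /HX; rewrite subr_gt0.
  have : 0 <= f X - m X - m X.
    apply: (@left_limit_ge0 R (fun y => f y - m y - m y)) => //.
      by apply: cvgB; [exact: cfm|exact: floor_fun_continuous].
    move=> y /(profile_ge_floor n_gt0 p_gt1 alpha_gt0 beta_gt0 A_gt0 pX).
    rewrite -/m; lra.
  have := m_gt0 X => h1 h2; rewrite gt_eqF//; lra.
split; first exact: mf.
by move=> X; apply: P => xi /andP[x0 _]; exact: mf.
Qed.

(** The lower barrier holds for g too, so g solves the truncated equation. On [0, +oo) both
    functions lie between 0 and A, hence differ by at most A, and [picard_unique] applies. *)
Lemma profile_unique (f g : R -> R) (Q : R -> R) :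
  continuous f -> f = picard f ->
  (forall xi, g xi = g `|xi|) ->
  (forall X, profile n p alpha beta A g Q X) ->
  g = integrate_slope n p alpha beta A (fun xi => g xi `^ (1 - p)) ->
  g = f.
Proof.
move=> cf fE gabs pg gE.
have [mf pf] := picard_fixpoint_profile cf fE.
have dom (xi : R) : 0 <= xi -> 0 <= xi < xi + 1 by move=> ->; rewrite ltrDl ltr01.
have mg xi : m xi < g xi.
  have -> : m xi = m `|xi| by rewrite /m /floor_fun normr_id.
  rewrite gabs; have := profile_ge_floor n_gt0 p_gt1 alpha_gt0 beta_gt0 A_gt0
    (pg _) (dom _ (normr_ge0 xi)).
  rewrite -/m; have := m_gt0 `|xi|; lra.
have gP : g = picard g.
  rewrite {1}gE /picard; congr (integrate_slope _ _ _ _ _ _).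
  by apply/funext => xi; rewrite truncated_eq.
apply: (@picard_unique _ _ A) => //.
- exact: prof_cont (pg 0).
- exact: ltW.
move=> s s0.
have := profile_le n_gt0 alpha_gt0 A_gt0 (pg _) (dom _ s0).
have := profile_le n_gt0 alpha_gt0 A_gt0 (pf _) (dom _ s0).
have := mg s; have := mf s s0; have := m_gt0 s => h1 h2 h3 h4 h5.
by rewrite ler_norml; apply/andP; split; lra.
Qed.

End picard.

(** * The initial value problem *)

Lemma derive1_val (R : realType) (f : R -> R) (x d : R) :
  is_derive x 1 f d -> derive1 f x = d.
Proof. by move=> df; rewrite derive1E derive_val. Qed.

Lemma profile_ivp (R : realType) (n : nat) (p alpha beta A : R)
    (f w : R -> R) :
  (0 < n)%N -> 1 < p -> 0 < alpha -> 0 < beta -> 0 < A ->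
  continuous w -> f = integrate_slope n p alpha beta A w ->
  (forall X, profile n p alpha beta A f (slope n p alpha beta w) X) ->
  ivp_solution n p alpha beta A f.
Proof.
move=> n0 p1 a0 b0 A0 cw fE pf; set Q := slope n p alpha beta w in pf.
have dom (xi : R) : 0 < xi -> 0 < xi < xi + 1 by move=> ->; rewrite ltrDl ltr01.
have df (xi : R) : 0 < xi -> is_derive xi 1 f (xi * Q xi).
  by move=> /dom h; exact: (prof_derive (pf _) h).
have dQ (xi : R) : 0 < xi -> is_derive xi 1 Q (flux n p alpha beta f Q xi / xi).
  by move=> /dom h; exact: (prof_deriveQ (pf _) h).
have f0 (xi : R) : 0 <= xi -> 0 < f xi.
  by move=> x0; apply: (prof_gt0 (pf (xi + 1))); rewrite x0 ltrDl ltr01.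
have ddf (xi : R) : 0 < xi ->
    is_derive xi 1 (derive1 f) (Q xi + flux n p alpha beta f Q xi).
  move=> x0; have H : \forall y \near xi, y * Q y = derive1 f y.
    near=> y; rewrite (derive1_val (df y _))//; near: y; exact: lt_nbhsr.
  apply: (near_eq_is_derive H).
  apply: (is_derive_cast (is_deriveM_fun (is_derive_id xi 1) (dQ xi x0))).
  by rewrite /= mulrCA mulfV ?gt_eqF//; ring.
have cf := prof_cont (pf 0); have cQ := prof_contQ (pf 0).
split.
- exact: f0.
- exact: continuous_subspaceT.
- by move=> xi /df [].
- by move=> xi /ddf [].
- move=> xi x0; suff : derive1 (derive1 f) y @[y --> xi] --> Q xi + flux n p alpha beta f Q xi.
    by rewrite -(derive1_val (ddf xi x0)).
  have H : \forall y \near xi, Q y + flux n p alpha beta f Q y = derive1 (derive1 f) y.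
    near=> y; rewrite (derive1_val (ddf y _))//; near: y; exact: lt_nbhsr.
  apply: cvg_trans (near_eq_cvg H) _.
  apply: cvgD; first exact: cQ.
  have cp r : (fun y => f y `^ r) @ xi --> f xi `^ r.
    apply: (@continuous_comp _ _ _ f (fun z => z `^ r)); first exact: cf.
    exact: is_derive_continuous (is_derive1_powR _ (f0 _ (ltW x0))).
  apply: cvgB; last by apply: cvgM; [exact: cvg_cst|exact: cQ].
  apply: cvgB; last by apply: cvgM; [exact: cvg_cst|exact: cp].
  apply: cvgN; apply: cvgM; last exact: cQ.
  apply: cvgM; last exact: cp.
  by apply: cvgM; [exact: cvg_cst|exact: exprn_continuous].
- move=> xi x0; rewrite (derive1_val (ddf xi x0)) (derive1_val (df xi x0)).
  have fx := f0 xi (ltW x0).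
  rewrite /flux powRN (powR_succ p fx) powR_opp_pred.
  have := powR_gt0 (p - 1) fx; move: (f xi `^ (p - 1)) => F F0.
  by field; rewrite !gt_eqF.
- exact: prof_init (pf 0).
(* As a C^1 function of xi^2, f even has a two-sided derivative 0 at the origin, which is then
   restricted to h > 0. *)
- have [D E] : is_derive (0 : R) 1 f 0.
    have := is_derive_integrate_slope (n := n) p alpha beta A n0 cw (lexx 0).
    by rewrite mul0r -fE.
  have : h^-1 *: ((f \o shift 0) (h *: 1) - f 0) @[h --> 0^'] --> 'D_1 f 0 by [].
  rewrite E => H.
  have -> : (fun h => h^-1 * (f h - f 0)) =
     (fun h => h^-1 *: ((f \o shift 0) (h *: 1) - f 0)).
    by apply/funext => h /=; rewrite addr0 /GRing.scale /= mulr1.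
  apply: cvg_trans H; apply: cvg_app => S [e /= e0 he].
  by exists e => // y ye y0; apply: he => //; rewrite gt_eqF.
- have H : \forall y \near (0:R)^'+, y * Q y = derive1 f y.
    near=> y; rewrite (derive1_val (df y _))//; near: y; exact: nbhs_right_gt.
  apply: cvg_trans (near_eq_cvg H) _.
  have : (fun y => y * Q y) @ (0:R) --> 0 * Q 0.
    by apply: cvgM; [exact: cvg_id|exact: cQ].
  rewrite mul0r; exact: cvg_at_right_filter.
Unshelve. all: by end_near.
Qed.

Lemma natr_exp_pred (R : realType) (k : nat) (x : R) : x != 0 ->
  k%:R * x ^+ k.-1 = k%:R * x ^+ k / x.
Proof.
by case: k => [|k] x0; [rewrite !mul0r|rewrite exprSr mulrA mulfK].
Qed.

(** The values of g on the negative half-line are arbitrary; the even reflection makes it comparable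
    with the fixed point, which is even. *)
Lemma ivp_even_continuous (R : realType) (n : nat) (p alpha beta A : R)
    (g : R -> R) :
  ivp_solution n p alpha beta A g -> continuous (fun xi : R => g `|xi|).
Proof.
move=> ig; have /continuous_within_itvcyP[cg cg0] := ivp_continuous ig.
move=> x; have [->|x0] := eqVneq x 0.
  rewrite /continuous_at normr0; apply/cvgrPdist_lt => e e0.
  move: cg0 => /cvgrPdist_lt /(_ _ e0) [d /= d0 hd].
  apply/nbhs_ballP; exists d => //= y yd.
  have [->|y0] := eqVneq y 0; first by rewrite normr0 subrr normr0.
  apply: hd => /=; last by rewrite normr_gt0.
  by move: yd; rewrite /ball /= !sub0r !normrN normr_id.
apply: (@continuous_comp _ _ _ (fun y : R => `|y|) g).
  by apply: cvg_norm; exact: cvg_id.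
by apply: cg; rewrite in_itv /= andbT normr_gt0.
Qed.

(* Multiplying the equation by xi^(n-1) f^(-p) makes it the derivative of
   xi^(n-1) g' - b xi^n w + (n b + alpha) \int_0^xi s^(n-1) w ds. *)
Lemma ivp_slope (R : realType) (n : nat) (p alpha beta A : R) (g w : R -> R) :
  (0 < n)%N -> 1 < p -> ivp_solution n p alpha beta A g ->
  continuous w -> (forall xi : R, 0 <= xi -> w xi = g xi `^ (1 - p)) ->
  forall xi : R, 0 < xi -> is_derive xi 1 g (xi * slope n p alpha beta w xi).
Proof.
move=> n0 p1 ig cw wE xi x0.
have p10 : 0 < p - 1 by rewrite subr_gt0.
pose b := beta / (p - 1); pose c := n%:R * b + alpha.
pose P := primitive (weighted n w).
pose T y := y ^+ n.-1 * derive1 g y - b * (y ^+ n * w y) + c * P y.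
have dP (y : R) : 0 <= y -> is_derive y 1 P (weighted n w y).
  move=> y0; apply: is_derive_primitive; first exact: weighted_continuous.
  by rewrite (lt_le_trans _ y0)// ltrN10.
have dT (y : R) : 0 < y -> is_derive y 1 T 0.
  move=> y0; have gy := ivp_gt0 ig (ltW y0).
  have dg : is_derive y 1 g (derive1 g y).
    by rewrite derive1E; exact: derivableP (ivp_derivable ig y0).
  have ddg : is_derive y 1 (derive1 g) (derive1 (derive1 g) y).
    by rewrite [X in is_derive _ _ _ X]derive1E; exact: derivableP (ivp_derivable2 ig y0).
  have dw : is_derive y 1 w ((1 - p) * g y `^ (1 - p - 1) * derive1 g y).
    apply: (near_eq_is_derive _ (is_derive_powR_fun (1 - p) dg gy)).
    near=> z; rewrite wE//; apply: ltW; near: z; exact: lt_nbhsr.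
  have D1 := is_deriveM_fun (is_deriveXn n.-1 y) ddg.
  have D2 := is_deriveZ_fun b (is_deriveM_fun (is_deriveXn n y) dw).
  have D3 := is_deriveZ_fun c (dP y (ltW y0)).
  apply: (is_derive_cast (is_deriveD_fun (is_deriveB_fun D1 D2) D3)).
  have yn0 : y != 0 by rewrite gt_eqF.
  have := ivp_ode ig y0.
  set g1 := derive1 g y; set g2 := derive1 _ y.
  have -> : g y `^ (1 - p - 1) = g y `^ (- p) by congr (_ `^ _); lra.
  rewrite natr_exp_pred// /weighted wE ?(ltW y0)// powRN (powR_succ p gy) powR_opp_pred.
  have F0 : 0 < g y `^ (p - 1) by exact: powR_gt0.
  have -> : y ^+ n = y * y ^+ n.-1 by rewrite -exprS prednK.
  have -> : n.-1%:R = n%:R - 1 :> R by rewrite -[in RHS](prednK n0) -natr1 addrK.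
  move: (g y `^ (p - 1)) F0 (y ^+ n.-1) => F F0 Y ode.
  (* The equation solved for the second derivative; inserting it makes the derivative of T vanish
     identically. *)
  have E : g2 = - ((beta * y * g1 + alpha * g y) / (F * g y) + (n%:R - 1) / y * g1).
    apply: (@mulfI _ (F * g y)); first by rewrite gt_eqF ?mulr_gt0.
    have -> : F * g y * g2 = (F * g y * (g2 + (n%:R - 1) / y * g1)
        + beta * y * g1 + alpha * g y) - (beta * y * g1 + alpha * g y)
        - F * g y * ((n%:R - 1) / y * g1) by ring.
    by rewrite ode; field; rewrite !gt_eqF.
  by rewrite E /c /b; field; rewrite !gt_eqF.
have Tc (y : R) : 0 < y -> y <= xi -> T y = T xi.
  move=> y0 yx; apply/eqP; rewrite eq_le; apply/andP; split.
    apply: (ge0_derive_le yx (df := fun=> 0)) => //.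
    - move=> z /andP[yz _]; exact: is_derive_continuous (dT z (lt_le_trans y0 yz)).
    - by move=> z /andP[yz _]; apply: dT; exact: lt_trans yz.
  rewrite -lerN2; apply: (ge0_derive_le yx (df := fun=> 0) (f := fun y => - T y)) => //.
  - move=> z /andP[yz _].
    exact: is_derive_continuous (is_deriveN_fun (dT z (lt_le_trans y0 yz))).
  - move=> z /andP[yz _]; apply: is_derive_cast (is_deriveN_fun (dT z (lt_trans y0 yz))) _.
    by rewrite oppr0.
(* For n = 1 the weight y^(n-1) is 1 at the origin, so the first term vanishes in the limit because
   g' tends to 0. *)
have T0 : T y @[y --> (0:R)^'+] --> (0 : R).
  have E0 : 0 ^+ n.-1 * 0 - b * (0 ^+ n * w 0) + c * P 0 = 0 :> R.
    by rewrite (expr0n _ n) eqn0Ngt n0 /= /P primitive0 !(mulr0, mul0r, subr0, addr0).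
  rewrite -[X in _ --> X]E0.
  apply: cvgD; last first.
    apply: cvg_at_right_filter; apply: cvgM; first exact: cvg_cst.
    exact: is_derive_continuous (dP 0 (lexx 0)).
  apply: cvgB.
    apply: cvgM; last exact: ivp_deriv_continuous0 ig.
    by apply: cvg_at_right_filter; exact: exprn_continuous.
  apply: cvg_at_right_filter; apply: cvgM; first exact: cvg_cst.
  by apply: cvgM; [exact: exprn_continuous|exact: cw].
have Txi : T xi = 0.
  have H : T y @[y --> (0:R)^'+] --> T xi.
    have E : \forall y \near (0:R)^'+, T xi = T y.
      near=> y; rewrite (Tc y)//.
      by apply: ltW; near: y; exact: nbhs_right_lt.
    by apply: cvg_trans (near_eq_cvg E) _; exact: cvg_cst.
  exact: (cvg_unique _ H T0).
have -> : xi * slope n p alpha beta w xi = derive1 g xi.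
  have xn0 : xi ^+ n.-1 != 0 by rewrite expf_neq0// gt_eqF.
  apply: (mulfI xn0); apply/eqP; rewrite -subr_eq0 -oppr_eq0; apply/eqP.
  rewrite -{}Txi /T /slope /average (ger0_norm (ltW x0)) gt_eqF// -/P -/b -/c.
  have -> : xi ^+ n = xi * xi ^+ n.-1 by rewrite -exprS prednK.
  by field; rewrite xn0 gt_eqF.
by rewrite derive1E; exact: derivableP (ivp_derivable ig x0).
Unshelve. all: by end_near.
Qed.

(** By [ivp_slope] the reflection of g and [integrate_slope] of its power have the same derivative
    on (0, +oo). They agree at 0 and are both even, hence they coincide, and [profile_slope]
    applies. *)
Lemma ivp_profile (R : realType) (n : nat) (p alpha beta A : R) (g : R -> R) :
  (0 < n)%N -> 1 < p -> 0 < alpha -> 0 < beta -> 0 < A ->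
  ivp_solution n p alpha beta A g ->
  let G := fun xi : R => g `|xi| in
  let w := fun xi => G xi `^ (1 - p) in
  G = integrate_slope n p alpha beta A w /\
  forall X, profile n p alpha beta A G (slope n p alpha beta w) X.
Proof.
move=> n0 p1 a0 b0 A0 ig G w.
have cG : continuous G := ivp_even_continuous ig.
have G0 (xi : R) : 0 < G xi by exact: (ivp_gt0 ig (normr_ge0 xi)).
have cw : continuous w.
  move=> x; apply: (@continuous_comp _ _ _ G (fun z => z `^ (1 - p))); first exact: cG.
  exact: is_derive_continuous (is_derive1_powR _ (G0 x)).
have wg (xi : R) : 0 <= xi -> w xi = g xi `^ (1 - p).
  by move=> x0; rewrite /w /G ger0_norm.
have dG (xi : R) : 0 < xi -> is_derive xi 1 G (xi * slope n p alpha beta w xi).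
  move=> x0; apply: (near_eq_is_derive _ (ivp_slope n0 p1 ig cw wg x0)).
  near=> y; rewrite /G ger0_norm//; apply: ltW; near: y; exact: lt_nbhsr.
have GE : G = integrate_slope n p alpha beta A w.
  apply/funext => x.
  have -> : integrate_slope n p alpha beta A w x =
      integrate_slope n p alpha beta A w `|x|.
    by rewrite /integrate_slope real_normK ?num_real.
  have -> : G x = G `|x| by rewrite /G normr_id.
  set y := `|x|; have y0 : 0 <= y by exact: normr_ge0.
  have cI : continuous (integrate_slope n p alpha beta A w).
    exact: integrate_slope_continuous.
  have dI (z : R) : 0 < z < y ->
      is_derive z 1 (integrate_slope n p alpha beta A w) (z * slope n p alpha beta w z).
    by move=> /andP[/ltW z0 _]; exact: is_derive_integrate_slope.
  have E0 : G 0 = A by rewrite /G normr0; exact: ivp_init ig.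
  have E1 : integrate_slope n p alpha beta A w 0 = A.
    by rewrite /integrate_slope expr0n /= primitive0 addr0.
  apply/eqP; rewrite eq_le; apply/andP; split; rewrite -subr_ge0.
    have -> : 0 = integrate_slope n p alpha beta A w 0 - G 0 by rewrite E0 E1 subrr.
    apply: (ge0_derive_le y0 (df := fun=> 0)
      (f := fun z => integrate_slope n p alpha beta A w z - G z)) => //.
    - by move=> z _; apply: cvgB; [exact: cI|exact: cG].
    - move=> z zy; have z0 : 0 < z by case/andP: zy.
      apply: is_derive_cast (is_deriveB_fun (dI z zy) (dG z z0)) _.
      by rewrite subrr.
  have -> : 0 = G 0 - integrate_slope n p alpha beta A w 0 by rewrite E0 E1 subrr.
  apply: (ge0_derive_le y0 (df := fun=> 0)
    (f := fun z => G z - integrate_slope n p alpha beta A w z)) => //.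
  - by move=> z _; apply: cvgB; [exact: cG|exact: cI].
  - move=> z zy; have z0 : 0 < z by case/andP: zy.
    apply: is_derive_cast (is_deriveB_fun (dG z z0) (dI z zy)) _.
    by rewrite subrr.
split=> // X; apply: profile_slope => //.
by rewrite wg// (ivp_init ig).
Unshelve. all: by end_near.
Qed.

(** * The self-similar solution *)

Lemma is_derive_line (R : realType) (V : normedModType R) (f : V -> R)
    (x v : V) (d : R) :
  is_derive (0 : R) 1 (fun h : R => f (h *: v + x)) d -> is_derive x v f d.
Proof.
move=> [D E]; apply: DeriveDef; first exact/derivable1P.
have H : (fun h : R => h^-1 *: ((f \o shift x) (h *: v) - f x)) =
  (fun h : R => h^-1 *: (((fun h : R => f (h *: v + x)) \o shift 0) (h *: 1)
     - f (0 *: v + x))).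
  by apply/funext => h /=; rewrite addr0 scale0r add0r [_%:A]mulr1.
by rewrite -E /derive H.
Qed.

(** Only continuity of f at 0 is required. This gives the second space derivatives at the origin,
    where the first ones have the form h times a continuous function of h. *)
Lemma is_derive_mul_id (R : realType) (f : R -> R) :
  {for 0, continuous f} -> is_derive (0 : R) 1 (fun h => h * f h) (f 0).
Proof.
move=> cf.
have H : h^-1 *: (((fun h => h * f h) \o shift 0) (h *: 1) - 0 * f 0) @[h --> 0^'] --> f 0.
  have E : \forall h \near (0:R)^', f h =
      h^-1 *: (((fun h => h * f h) \o shift 0) (h *: 1) - 0 * f 0).
    near=> h; rewrite /= addr0 mul0r subr0 /GRing.scale /= mulr1 mulKf//.
    by near: h; exact: nbhs_dnbhs_neq.
  apply: cvg_trans (near_eq_cvg E) _.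
  by apply: cvg_trans cf; apply: cvg_app; exact: cvg_within.
apply: DeriveDef; first by apply/cvg_ex; exists (f 0).
exact: cvg_lim H.
Unshelve. all: by end_near.
Qed.

Lemma cvg_continuous_comp (T : Type) (F : set_system T) (FF : Filter F)
    (V U : topologicalType) (f : T -> V) (h : V -> U) (a : V) :
  f @ F --> a -> {for a, continuous h} -> (fun z => h (f z)) @ F --> h a.
Proof. by move=> fa ha; exact: continuous_cvg ha fa. Qed.

Definition sqnorm (R : realType) (n : nat) (x : 'rV[R]_n) : R :=
  \sum_(i < n) x ord0 i ^+ 2.

Lemma sqnorm_ge0 (R : realType) (n : nat) (x : 'rV[R]_n) : 0 <= sqnorm x.
Proof. by apply: sumr_ge0 => i _; exact: sqr_ge0. Qed.

Lemma coord_sqr_le (R : realType) (n : nat) (x : 'rV[R]_n) (i : 'I_n) :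
  x ord0 i ^+ 2 <= sqnorm x.
Proof.
rewrite /sqnorm (bigD1 i)//= lerDl.
by apply: sumr_ge0 => j _; exact: sqr_ge0.
Qed.

(** This bounds x_i x_j / |x|^2 by 1, so a factor tending to 0 suffices for continuity at the
    origin. *)
Lemma coord_mul_le (R : realType) (n : nat) (x : 'rV[R]_n) (i j : 'I_n) :
  `|x ord0 i * x ord0 j| <= sqnorm x.
Proof.
have hi := coord_sqr_le x i; have hj := coord_sqr_le x j.
rewrite normrM.
have := sqr_ge0 (`|x ord0 i| - `|x ord0 j|).
rewrite sqrrB !real_normK ?num_real//; lra.
Qed.

Lemma sqnorm_eq0 (R : realType) (n : nat) (x : 'rV[R]_n) (i : 'I_n) :
  sqnorm x = 0 -> x ord0 i = 0.
Proof.
move=> N0; have := coord_sqr_le x i; rewrite N0 => h.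
by apply/eqP; rewrite -sqrf_eq0 eq_le h sqr_ge0.
Qed.

Lemma sqnorm_line (R : realType) (n : nat) (x : 'rV[R]_n) (i : 'I_n) (h : R) :
  sqnorm (h *: delta_mx ord0 i + x) = sqnorm x + 2 * x ord0 i * h + h ^+ 2.
Proof.
rewrite /sqnorm (bigD1 i)//= [in RHS](bigD1 i)//= !mxE !eqxx /= mulr1.
rewrite (eq_bigr (fun j => x ord0 j ^+ 2)); first by ring.
by move=> j ji; rewrite !mxE (negbTE ji) andbF mulr0 add0r.
Qed.

Lemma sqnorm_continuous (R : realType) (n : nat) :
  continuous (fun x : 'rV[R]_n => sqnorm x).
Proof.
rewrite /sqnorm; elim: (index_enum _) => [|i s IH].
  rewrite (_ : (fun _ => _) = cst 0); first by move=> x; exact: cst_continuous.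
  by apply/funext => x; rewrite big_nil.
rewrite (_ : (fun _ => _) =
  (fun x : 'rV[R]_n => x ord0 i ^+ 2 + \sum_(k <- s) x ord0 k ^+ 2)); last first.
  by apply/funext => x; rewrite big_cons.
move=> x; apply: cvgD; [exact: nbhs_filter| |exact: IH].
by apply: cvgM; [exact: nbhs_filter|exact: coord_continuous..].
Qed.

(** * Regularity of the self-similar function and its equation *)

Section selfsimilar.
Context (R : realType) (n : nat) (p alpha beta A : R) (f w : R -> R).
Context (n_gt0 : (0 < n)%N) (w_cont : continuous w).
Let Q := slope n p alpha beta w.
Context (fE : f = integrate_slope n p alpha beta A w)
  (pf : forall X, profile n p alpha beta A f Q X)
  (exponents : p * alpha + 2 * beta = 1).

Definition selfsimilar (x : 'rV[R]_n) (t : R) : R :=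
  t `^ (- alpha) * f (t `^ (- beta) * enorm x).

(** S is the similarity variable xi, F stands for xi Q', and K is the power t^(- alpha - 2 beta)
    common to the space derivatives. *)
Let S (x : 'rV[R]_n) (t : R) : R := t `^ (- beta) * Num.sqrt (sqnorm x).
Let F := flux n p alpha beta f Q.
Let K (t : R) : R := t `^ (- alpha) * (t `^ (- beta)) ^+ 2.

Let dom (xi : R) : 0 <= xi -> 0 <= xi < xi + 1.
Proof. by move=> ->; rewrite ltrDl ltr01. Qed.

Let f_gt0 (xi : R) : 0 < f xi.
Proof.
have -> : f xi = f `|xi|.
  by rewrite fE /integrate_slope real_normK ?num_real.
exact: (prof_gt0 (pf _) (dom (normr_ge0 xi))).
Qed.

Let f_cont : continuous f. Proof. exact: prof_cont (pf 0). Qed.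
Let Q_cont : continuous Q. Proof. exact: prof_contQ (pf 0). Qed.

Let F_cont : continuous F.
Proof.
move=> x.
have cp r : (fun y => f y `^ r) @ x --> f x `^ r.
  apply: (@continuous_comp _ _ _ f (fun z => z `^ r)); first exact: f_cont.
  exact: is_derive_continuous (is_derive1_powR _ (f_gt0 _)).
apply: cvgB; last by apply: cvgM; [exact: cvg_cst|exact: Q_cont].
apply: cvgB; last by apply: cvgM; [exact: cvg_cst|exact: cp].
apply: cvgN; apply: cvgM; last exact: Q_cont.
apply: cvgM; last exact: cp.
by apply: cvgM; [exact: cvg_cst|exact: exprn_continuous].
Qed.

Let F0 : F 0 = 0.
Proof.
rewrite /F /flux (prof_initQ (pf 0)) (prof_init (pf 0)).
have : n%:R != 0 :> R by rewrite pnatr_eq0 -lt0n.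
by move=> nn; rewrite expr0n /=; field.
Qed.

Let S_ge0 (x : 'rV[R]_n) t : 0 <= S x t.
Proof. by rewrite mulr_ge0 ?powR_ge0 ?sqrtr_ge0. Qed.

Let S_sqr x t : S x t ^+ 2 = (t `^ (- beta)) ^+ 2 * sqnorm x.
Proof. by rewrite exprMn sqr_sqrtr// sqnorm_ge0. Qed.

(** Written through |x|^2, the function can be differentiated once in x without differentiating the
    norm at the origin. *)
Lemma selfsimilarE x t : selfsimilar x t =
  t `^ (- alpha) * (A + primitive (half_slope n p alpha beta w)
    ((t `^ (- beta)) ^+ 2 * sqnorm x)).
Proof. by rewrite -S_sqr /selfsimilar fE. Qed.

Let halfE x t : half_slope n p alpha beta w ((t `^ (- beta)) ^+ 2 * sqnorm x) =
  Q (S x t) / 2.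
Proof. by rewrite -S_sqr /half_slope sqrtr_sqr ger0_norm. Qed.

Let is_derive_P x t : is_derive ((t `^ (- beta)) ^+ 2 * sqnorm x) 1
   (primitive (half_slope n p alpha beta w)) (Q (S x t) / 2).
Proof.
rewrite -halfE; apply: is_derive_half_slope => //.
by rewrite -S_sqr (lt_le_trans _ (sqr_ge0 _))// ltrN10.
Qed.

Lemma is_derive_selfsimilar_t (x : 'rV[R]_n) (t : R) : 0 < t ->
  is_derive t 1 (selfsimilar x)
    (t `^ (- alpha) / t *
      (- alpha * f (S x t) - beta * S x t ^+ 2 * Q (S x t))).
Proof.
move=> t0.
have -> : selfsimilar x = (fun t => t `^ (- alpha) *
  (A + primitive (half_slope n p alpha beta w)
    ((t `^ (- beta)) ^+ 2 * sqnorm x))).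
  by apply/funext => s; exact: selfsimilarE.
have D1 := is_derive1_powR (- beta) t0.
have D2 := is_derive_comp_fun D1 (is_deriveXn 2 (t `^ (- beta))).
have D3 := is_derive_comp_fun
  (is_deriveM_fun D2 (is_derive_cst (sqnorm x) t 1)) (is_derive_P x t).
have D4 := is_deriveM_fun (is_derive1_powR (- alpha) t0)
  (is_deriveD_fun (is_derive_cst A t 1) D3).
apply: (is_derive_cast D4).
rewrite !powR_pred//.
have -> : f (S x t) = A + primitive (half_slope n p alpha beta w)
    ((t `^ (- beta)) ^+ 2 * sqnorm x).
  by rewrite -S_sqr fE.
rewrite S_sqr /= expr1; set P := primitive _ _.
by field; rewrite gt_eqF.
Qed.

Lemma is_derive_selfsimilar_x (i : 'I_n) (x : 'rV[R]_n) (t : R) :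
  is_derive x (delta_mx ord0 i) (fun y => selfsimilar y t)
    (K t * Q (S x t) * x ord0 i).
Proof.
apply: is_derive_line.
have -> : (fun h : R => selfsimilar (h *: delta_mx ord0 i + x) t) =
  (fun h : R => t `^ (- alpha) *
  (A + primitive (half_slope n p alpha beta w)
    ((t `^ (- beta)) ^+ 2 * (sqnorm x + 2 * x ord0 i * h + h ^+ 2)))).
  by apply/funext => h; rewrite selfsimilarE sqnorm_line.
have D1 := is_deriveZ_fun ((t `^ (- beta)) ^+ 2) (is_deriveD_fun
  (is_deriveD_fun (is_derive_cst (sqnorm x) (0 : R) 1)
    (is_deriveZ_fun (2 * x ord0 i) (is_derive_id (0 : R) 1))) (is_deriveXn 2 0)).
have DP : is_derive ((t `^ (- beta)) ^+ 2 * (sqnorm x + 2 * x ord0 i * 0 + 0 ^+ 2)) 1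
    (primitive (half_slope n p alpha beta w)) (Q (S x t) / 2).
  by rewrite mulr0 expr0n /= !addr0.
have D2 := is_derive_comp_fun D1 DP.
have D3 := is_deriveZ_fun (t `^ (- alpha)) (is_deriveD_fun (is_derive_cst A (0 : R) 1) D2).
apply: (is_derive_cast D3).
by rewrite /K /= expr1; field.
Qed.

Lemma dspace_selfsimilar (i : 'I_n) (t : R) :
  (fun y => dspace i selfsimilar y t) = (fun y => K t * Q (S y t) * y ord0 i).
Proof.
apply/funext => y; rewrite /dspace.
by have [_ ->] := is_derive_selfsimilar_x i y t.
Qed.

Lemma is_derive_selfsimilar_xx (i j : 'I_n) (x : 'rV[R]_n) (t : R) : 0 < t ->
  is_derive x (delta_mx ord0 j) (fun y => dspace i selfsimilar y t)
    (K t * ((i == j)%:R * Q (S x t) +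
            x ord0 i * x ord0 j * F (S x t) / sqnorm x)).
Proof.
move=> t0; rewrite dspace_selfsimilar; apply: is_derive_line.
pose d : R := (i == j)%:R.
have Ed h : (h *: delta_mx ord0 j + x) ord0 i = h * d + x ord0 i :> R.
  by rewrite !mxE eqxx.
have b0 : 0 < t `^ (- beta) by exact: powR_gt0.
(* At the origin the quotient is 0 by the convention 0^-1 = 0, and the derivative comes from
   [is_derive_mul_id]. Elsewhere Q composed with the norm is differentiated by the chain rule. *)
have [N0|Np] := eqVneq (sqnorm x) 0.
  rewrite N0 invr0 mulr0 addr0.
  have cS : {for 0, continuous (fun h : R => K t * d * Q (t `^ (- beta) * Num.sqrt (h ^+ 2)))}.
    apply: cvgM; first exact: cvg_cst.
    apply: (@continuous_comp _ _ _ (fun h : R => t `^ (- beta) * Num.sqrt (h ^+ 2)) Q).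
      apply: cvgM; first exact: cvg_cst.
      apply: (@continuous_comp _ _ _ (fun h : R => h ^+ 2) (@Num.sqrt R)).
        exact: exprn_continuous.
      exact: sqrt_continuous.
    exact: Q_cont.
  have -> : (fun h : R => K t * Q (S (h *: delta_mx ord0 j + x) t) *
      (h *: delta_mx ord0 j + x) ord0 i) =
      (fun h : R => h * (K t * d * Q (t `^ (- beta) * Num.sqrt (h ^+ 2)))).
    apply/funext => h; rewrite Ed /S sqnorm_line N0 !(sqnorm_eq0 _ N0).
    by rewrite mulr0 mul0r !add0r addr0; ring.
  apply: (is_derive_cast (is_derive_mul_id cS)).
  by rewrite /S N0 expr0n /= -/d; ring.
have {}Np : 0 < sqnorm x by rewrite lt_neqAle eq_sym Np sqnorm_ge0.
have -> : (fun h : R => K t * Q (S (h *: delta_mx ord0 j + x) t) *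
      (h *: delta_mx ord0 j + x) ord0 i) =
  (fun h : R => K t * Q (t `^ (- beta) * Num.sqrt (sqnorm x + 2 * x ord0 j * h + h ^+ 2))
      * (d * h + x ord0 i)).
  by apply/funext => h; rewrite Ed /S sqnorm_line [d * h]mulrC.
have D1 := is_deriveD_fun
  (is_deriveD_fun (is_derive_cst (sqnorm x) (0 : R) 1)
    (is_deriveZ_fun (2 * x ord0 j) (is_derive_id (0 : R) 1))) (is_deriveXn 2 0).
have E0 : sqnorm x + 2 * x ord0 j * 0 + 0 ^+ 2 = sqnorm x.
  by rewrite mulr0 expr0n /= !addr0.
have Dsqrt : is_derive (sqnorm x + 2 * x ord0 j * 0 + 0 ^+ 2) 1 (@Num.sqrt R)
    (2 * Num.sqrt (sqnorm x))^-1.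
  by rewrite E0; exact: is_derive1_sqrt.
have D2 := is_deriveZ_fun (t `^ (- beta)) (is_derive_comp_fun D1 Dsqrt).
have Sp : 0 < S x t by rewrite mulr_gt0// sqrtr_gt0.
have DQ : is_derive (t `^ (- beta) * Num.sqrt (sqnorm x + 2 * x ord0 j * 0 + 0 ^+ 2))
    1 Q (F (S x t) / S x t).
  rewrite E0 -/(S x t); apply: (prof_deriveQ (pf (S x t + 1))).
  by rewrite Sp ltrDl ltr01.
have D3 := is_deriveZ_fun (K t) (is_derive_comp_fun D2 DQ).
have D4 := is_deriveM_fun D3 (is_deriveD_fun
  (is_deriveZ_fun d (is_derive_id (0 : R) 1)) (is_derive_cst (x ord0 i) (0 : R) 1)).
apply: (is_derive_cast D4).
rewrite /= E0 -/(S x t) -/d expr1.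
have EN : sqnorm x = Num.sqrt (sqnorm x) ^+ 2 by rewrite sqr_sqrtr// ltW.
have sp : 0 < Num.sqrt (sqnorm x) by rewrite sqrtr_gt0.
move: (Q (S x t)) (F (S x t)) => q g; rewrite [in RHS]EN /S.
move: (Num.sqrt (sqnorm x)) sp (t `^ (- beta)) b0 => s sp b b0.
by field; rewrite !gt_eqF.
Qed.

Let cvg_time (t : R) (x : 'rV[R]_n) :
  (fun z : 'rV[R]_n * R => z.2) @ (x, t) --> t.
Proof. exact: cvg_snd. Qed.

Let cvg_space (t : R) (x : 'rV[R]_n) :
  (fun z : 'rV[R]_n * R => z.1) @ (x, t) --> x.
Proof. exact: cvg_fst. Qed.

Let cvg_powR_t (r t : R) (x : 'rV[R]_n) : 0 < t ->
  (fun z : 'rV[R]_n * R => z.2 `^ r) @ (x, t) --> t `^ r.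
Proof.
move=> t0.
exact: (cvg_continuous_comp (nbhs_filter (x, t)) (@cvg_time t x)
  (is_derive_continuous (is_derive1_powR r t0))).
Qed.

Let cvg_sqnorm (t : R) (x : 'rV[R]_n) :
  (fun z : 'rV[R]_n * R => sqnorm z.1) @ (x, t) --> sqnorm x.
Proof.
exact: (cvg_continuous_comp (nbhs_filter (x, t)) (@cvg_space t x)
  (@sqnorm_continuous _ _ x)).
Qed.

Let cvg_S (t : R) (x : 'rV[R]_n) : 0 < t ->
  (fun z : 'rV[R]_n * R => S z.1 z.2) @ (x, t) --> S x t.
Proof.
move=> t0; apply: cvgM; first exact: cvg_powR_t.
exact: (cvg_continuous_comp (nbhs_filter (x, t)) (@cvg_sqnorm t x) (@sqrt_continuous R _)).
Qed.

Let cvg_S_comp (g : R -> R) (t : R) (x : 'rV[R]_n) : continuous g -> 0 < t ->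
  (fun z : 'rV[R]_n * R => g (S z.1 z.2)) @ (x, t) --> g (S x t).
Proof.
by move=> cg t0; exact: (cvg_continuous_comp (nbhs_filter (x, t))
  (@cvg_S t x t0) (cg _)).
Qed.

Let cvg_coord (i : 'I_n) (t : R) (x : 'rV[R]_n) :
  (fun z : 'rV[R]_n * R => z.1 ord0 i) @ (x, t) --> x ord0 i.
Proof.
exact: (cvg_continuous_comp (nbhs_filter (x, t)) (@cvg_space t x)
  (@coord_continuous R 1 n ord0 i x)).
Qed.

Let cvg_K (t : R) (x : 'rV[R]_n) : 0 < t ->
  (fun z : 'rV[R]_n * R => K z.2) @ (x, t) --> K t.
Proof.
move=> t0; apply: cvgM; first exact: cvg_powR_t.
exact: (cvg_continuous_comp (nbhs_filter (x, t)) (@cvg_powR_t (- beta) t x t0)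
  (@exprn_continuous R 2 _)).
Qed.

(** Away from the origin this is a quotient of continuous functions. At the origin x_i x_j / |x|^2
    stays bounded by 1 while F tends to F 0 = 0, which matches the value given by 0^-1 = 0. *)
Let cvg_radial (i j : 'I_n) (t : R) (x : 'rV[R]_n) : 0 < t ->
  (fun z : 'rV[R]_n * R =>
    z.1 ord0 i * z.1 ord0 j * F (S z.1 z.2) / sqnorm z.1) @ (x, t)
  --> x ord0 i * x ord0 j * F (S x t) / sqnorm x.
Proof.
move=> t0.
have cN := @cvg_sqnorm t x.
have cF := @cvg_S_comp F t x F_cont t0.
have [N0|Np] := eqVneq (sqnorm x) 0.
  rewrite N0 invr0 mulr0; apply/cvgrPdist_le => e e0.
  have S0 : S x t = 0 by rewrite /S N0 sqrtr0 mulr0.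
  move: cF; rewrite S0 F0 => /cvgrPdist_le /(_ _ e0).
  apply: filterS => z; rewrite !sub0r !normrN; apply: le_trans.
  rewrite normrM normrM mulrAC ler_piMl//.
  have [M0|Mp] := eqVneq (sqnorm z.1) 0; first by rewrite M0 invr0 normr0 mulr0.
  have {}Mp : 0 < sqnorm z.1 by rewrite lt_neqAle eq_sym Mp sqnorm_ge0.
  by rewrite normfV (gtr0_norm Mp) ler_pdivrMr// mul1r coord_mul_le.
apply: cvgM; last exact: cvgV.
by apply: cvgM => //; apply: cvgM; exact: cvg_coord.
Qed.

Lemma selfsimilar_pcs : positive_classical_solution p selfsimilar.
Proof.
have dt (x : 'rV[R]_n) (t : R) : 0 < t ->
    dtime selfsimilar x t = t `^ (- alpha) / t *
      (- alpha * f (S x t) - beta * S x t ^+ 2 * Q (S x t)).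
  by move=> t0; rewrite /dtime (derive1_val (is_derive_selfsimilar_t x t0)).
have dx (i : 'I_n) (x : 'rV[R]_n) (t : R) :
    dspace i selfsimilar x t = K t * Q (S x t) * x ord0 i.
  exact: (congr1 (@^~ x) (dspace_selfsimilar i t)).
have dxx (i j : 'I_n) (x : 'rV[R]_n) (t : R) : 0 < t ->
    dspace j (dspace i selfsimilar) x t =
   K t * ((i == j)%:R * Q (S x t) +
            x ord0 i * x ord0 j * F (S x t) / sqnorm x).
  move=> t0; rewrite {1}/dspace.
  by have [_ ->] := is_derive_selfsimilar_xx i j x t0.
have near_t (x : 'rV[R]_n) (t : R) : 0 < t -> \forall z \near (x, t), 0 < z.2.
  by move=> t0; have /cvgr_gt /(_ _ t0) := @cvg_time t x; apply.
have cont (g h : 'rV[R]_n -> R -> R) :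
  (forall (x : 'rV[R]_n) (t : R), 0 < t -> g x t = h x t) ->
  (forall (x : 'rV[R]_n) (t : R), 0 < t ->
    (fun z : 'rV[R]_n * R => h z.1 z.2) @ (x, t) --> h x t) ->
  continuous_Qoo g.
  move=> gh hc x t t0.
  suff : (fun z : 'rV[R]_n * R => g z.1 z.2) @ (x, t) --> h x t by rewrite -gh.
  have E : \forall z \near (x, t), h z.1 z.2 = g z.1 z.2.
    by apply: filterS (near_t x t t0) => z z0; rewrite gh.
  by apply: cvg_trans (near_eq_cvg E) _; exact: hc.
split.
- by move=> x t t0; rewrite mulr_gt0 ?powR_gt0.
- split.
  + by move=> x t t0; have [] := is_derive_selfsimilar_t x t0.
  + by move=> i x t _; have [] := is_derive_selfsimilar_x i x t.
  + by move=> i j x t t0; have [] := is_derive_selfsimilar_xx i j x t0.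
  + apply: (cont _ (fun x t => t `^ (- alpha) * f (S x t))) => // x t t0.
    by apply: cvgM; [exact: cvg_powR_t|exact: cvg_S_comp].
  + apply: (cont _ _ dt) => x t t0.
    apply: cvgM.
      apply: cvgM; first exact: cvg_powR_t.
      by apply: cvgV; [rewrite gt_eqF|exact: cvg_snd].
    apply: cvgB; first by apply: cvgM; [exact: cvg_cst|exact: cvg_S_comp].
    apply: cvgM; last exact: cvg_S_comp.
    apply: cvgM; first exact: cvg_cst.
    by apply: (cvg_S_comp (g := fun s => s ^+ 2)) => //; exact: exprn_continuous.
  + move=> i; apply: (cont _ _ (fun x t _ => dx i x t)) => x t t0.
    apply: cvgM; last exact: cvg_coord.
    by apply: cvgM; [exact: cvg_K|exact: cvg_S_comp].
  + move=> i j; apply: (cont _ _ (dxx i j)) => x t t0.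
    apply: cvgM; first exact: cvg_K.
    apply: cvgD; last exact: cvg_radial.
    by apply: cvgM; [exact: cvg_cst|exact: cvg_S_comp].
move=> x t t0; rewrite dt// /laplacian.
(* Summing the diagonal second derivatives gives the Laplacian K (n Q + F). *)
rewrite (eq_bigr (fun i => K t * (Q (S x t)) +
  K t * F (S x t) / sqnorm x * x ord0 i ^+ 2)); last first.
  by move=> i _; rewrite dxx// eqxx /= mul1r; ring.
rewrite big_split /= sumr_const card_ord -mulr_sumr -/(sqnorm x).
(* At the origin nothing can be cancelled, but both sides vanish because F 0 = 0. *)
have -> : K t * F (S x t) / sqnorm x * sqnorm x = K t * F (S x t).
  have [N0|Np] := eqVneq (sqnorm x) 0; last by rewrite divfK.
  by rewrite N0 mulr0 /S N0 sqrtr0 mulr0 F0 mulr0.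
rewrite -mulr_natr.
rewrite /selfsimilar -/(sqnorm x) -/(S x t) powRM ?powR_ge0 ?(ltW (f_gt0 _))//.
set xi := S x t; have fx := f_gt0 xi.
rewrite /F /flux (powRN (f xi)) (powR_succ p fx) powR_opp_pred.
(* The relation p alpha + 2 beta = 1 balances the powers of t on the two sides of the equation. *)
have T : t^-1 = (t `^ (- alpha)) `^ p * (t `^ (- beta)) ^+ 2.
  rewrite -powR_mulrn ?powR_ge0// -!powRrM -powRD; last first.
    by apply/implyP => _; rewrite gt_eqF.
  have -> : - alpha * p + - beta * 2%:R = - (p * alpha + 2 * beta) by ring.
  rewrite exponents powR_inv1 //; exact: ltW.
rewrite T /K.
move: (f xi `^ (p - 1)) (powR_gt0 (p - 1) fx) => G G0.
by field; rewrite !gt_eqF.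
Qed.

End selfsimilar.

Unset Implicit Arguments.

Theorem theorem1p5 (R : realType) (n : nat) (p alpha A : R)
    (n_ge1 : (1 <= n)%N) (p_gt1 : 1 < p)
    (alpha_gt0 : 0 < alpha) (alpha_lt : alpha < 1 / p) (A_gt0 : 0 < A) :
  let beta := (1 - p * alpha) / 2 in
  exists (u : 'rV[R]_n -> R -> R) (f : R -> R),
    positive_classical_solution p u /\
    radially_symmetric u /\
    (forall (x : 'rV[R]_n) (t : R), 0 < t ->
       u x t = t `^ (- alpha) * f (t `^ (- beta) * enorm x)) /\
    ivp_solution n p alpha beta A f /\
    (forall g : R -> R, ivp_solution n p alpha beta A g ->
       forall xi : R, 0 <= xi -> g xi = f xi) /\
    (exists c C : R, 0 < c /\ 0 < C /\
       forall xi : R, 0 <= xi ->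
         c * (1 + xi) `^ (- (alpha / beta)) <= f xi /\
         f xi <= C * (1 + xi) `^ (- (alpha / beta))).
Proof.
move=> beta.
have p0 : 0 < p by rewrite (lt_trans ltr01).
have beta_gt0 : 0 < beta.
  by rewrite divr_gt0// subr_gt0 mulrC -ltr_pdivlMr.
have [f cf fE] := picard_fixpoint n_ge1 p_gt1 alpha_gt0 beta_gt0 A_gt0.
have [mf pf] := picard_fixpoint_profile n_ge1 p_gt1 alpha_gt0 beta_gt0 A_gt0 cf fE.
have cw : continuous (truncated n p alpha beta A f) by exact: truncated_continuous.
exists (selfsimilar alpha beta f), f.
split; last split; last split; last split; last split.
- have exponents : p * alpha + 2 * beta = 1 by rewrite /beta; field.
  exact: (selfsimilar_pcs n_ge1 cw fE pf exponents).
- by move=> x y t _ E; rewrite /selfsimilar E.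
- by [].
- exact: (profile_ivp n_ge1 p_gt1 alpha_gt0 beta_gt0 A_gt0 cw fE pf).
- move=> g ig xi x0.
  (* Uniqueness is proved for the even reflection of g, which equals g on [0, +oo). *)
  have [gE pg] := ivp_profile n_ge1 p_gt1 alpha_gt0 beta_gt0 A_gt0 ig.
  have Gf := profile_unique n_ge1 p_gt1 alpha_gt0 beta_gt0 A_gt0 cf fE _ pg gE.
  rewrite -Gf; first by rewrite ger0_norm.
  by move=> y; rewrite normr_id.
have [C C0 fC] := profile_upper n_ge1 p_gt1 alpha_gt0 beta_gt0 A_gt0 pf.
exists (floor_coef n p alpha beta A), C; split.
  exact: floor_coef_gt0.
split=> // xi x0; split; last exact: fC.
by have := mf xi x0; rewrite /floor_fun (ger0_norm x0) => /ltW.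
Qed.
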